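(* Let $H$ be a Hilbert space. For $t\ge0$ let $A(t)$ and $B(t)$ be bounded linear operators in $H$, such that $$\mathrm{Re}(A(t)u,u)\le0\quad\forall u\in H,\ \forall t\ge0,$$ and $$C:=\int_0^\infty\|B(t)\|\,dt<\infty.$$ Then the solution to the problem $$\dot u=A(t)u+B(t)u,\qquad u(0)=u_0,$$ with $u_0\in H$, exists on $\mathbb{R}_+$, is unique, and satisfies $$\sup_{t\ge0}\|u(t)\|\le e^C\|u_0\|.$$
   Context: $\mathbb{R}_+:=[0,\infty)$; $(\cdot,\cdot)$ and $\|\cdot\|$ denote the inner product and norm of $H$ (and $\|B(t)\|$ the operator norm); $\dot u=du/dt$.
   Formalization: A(t), B(t) are assumed strongly measurable in t, ‖A(t)‖ locally integrable, ‖B(t)‖ measurable, and solutions are locally absolutely continuous with the equation a.e. (everywhere if A, B are strongly continuous); without regularity existence fails, e.g. A(t)=i/(t-1)^2 on H=C. *)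

(* Defs.v *)
From HB Require Import structures.
From mathcomp Require Import all_boot all_order all_algebra complex.
From mathcomp Require Import all_classical all_reals all_analysis.

Set Implicit Arguments.
Unset Strict Implicit.
Unset Printing Implicit Defensive.

Import Order.TTheory GRing.Theory Num.Theory.
Import numFieldNormedType.Exports.

Local Open Scope classical_set_scope.
Local Open Scope ring_scope.

Local Notation Rplus := `[0, +oo[%classic.

Section Hilbert.
Variables (R : realType) (H : completeNormedModType R[i]).

(* A complex Hilbert space is a complete normed R[i]-module whose norm comes
   from a positive definite Hermitian form, linear in its first argument. *)
Definition is_hilbert (ip : {dot H for Num.conj}) : Prop :=
  forall x : H, `|x| ^+ 2 = ip x x.

(* The library norm of H takes its (real, nonnegative) values in R[i]. *)
Definition rnorm (x : H) : R := complex.Re `|x|.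

Definition opnorm (f : {linear H -> H}) : R :=
  sup [set rnorm (f x) | x in [set x | rnorm x <= 1]].

Definition simple_fun (g : R -> H) : Prop :=
  finite_set (range g) /\
  forall y : H, measurable (g @^-1` [set y] : set (measurableTypeR R)).

Definition strongly_measurable (f : R -> H) : Prop :=
  exists2 g : nat -> R -> H, (forall n, simple_fun (g n)) &
    {ae @lebesgue_measure R,
      forall t, 0 <= t -> g n t @[n --> \oo] --> f t}.

Definition strongly_measurable_op (A : R -> {linear H -> H}) : Prop :=
  forall x, strongly_measurable (fun t => A t x).

Definition strongly_continuous_op (A : R -> {linear H -> H}) : Prop :=
  forall x, {within Rplus, continuous (fun t => A t x)}.

Definition absolutely_continuous (a b : R) (u : R -> H) : Prop :=
  forall e : R, 0 < e -> exists2 d : R, 0 < d &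
    forall (n : nat) (x y : nat -> R),
      (forall i, (i < n)%N -> [/\ a <= x i, x i <= y i & y i <= b]) ->
      (forall i, (i.+1 < n)%N -> y i <= x i.+1) ->
      \sum_(i < n) (y i - x i) < d ->
      \sum_(i < n) rnorm (u (y i) - u (x i)) < e.

(* Derivative in the norm of H relative to [0, +oo[: two-sided at t > 0,
   right-sided at t = 0. *)
Definition has_derivative (u : R -> H) (t : R) (l : H) : Prop :=
  (h^-1)%:C%C *: (u (t + h) - u t)
    @[h --> within [set h | 0 <= t + h] 0^'] --> l.

(* Solutions in the sense of Caratheodory, since nothing forces A and B to be
   continuous in t. *)
Definition is_solution (A B : R -> {linear H -> H}) (u0 : H) (u : R -> H)
    : Prop :=
  [/\ forall T : R, 0 <= T -> absolutely_continuous 0 T u,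
      {ae @lebesgue_measure R, forall t, 0 <= t ->
        has_derivative u t (A t (u t) + B t (u t))}
    & u 0 = u0].

End Hilbert.

(* Main.v *)
Require Import Defs.
From HB Require Import structures.
From mathcomp Require Import all_boot all_order all_algebra complex.
From mathcomp Require Import all_classical all_reals all_analysis.
From mathcomp Require Import measurable_realfun ring lra.

Set Implicit Arguments.
Unset Strict Implicit.
Unset Printing Implicit Defensive.

Import Order.TTheory GRing.Theory Num.Theory.
Import numFieldNormedType.Exports.

Local Open Scope classical_set_scope.
Local Open Scope ring_scope.

(** Write M t = A t + B t, and let m t = |A t| + |B t| be the locally integrable
    bound on its operator norm.  A solution is an absolutely continuous curve
    with u' = M u almost everywhere, equivalently a continuous u with
    u t = u0 + int_0^t M s (u s) ds.

    The integral is taken weakly.  For a separably valued measurable f with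
    |f| locally integrable, x |-> int_0^t Re (f s, x) ds is a bounded real-linear
    functional, and Riesz representation (riesz) turns it into a vector
    (weak_primitive_exists).  Testing the difference of two such integrals
    against itself gives |int f - int g| <= int |f - g| (weak_primitive_dist),
    and every property of the integral that is needed follows from this bound:
    absolute continuity, the contraction estimate, and differentiability.  For
    the latter, f t is a limit of the countably many values y_k, and almost every
    t is a Lebesgue point of each real function |f - y_k|, so the difference
    quotients of int f converge to f t (ae_straddle_derivative).  Measurability
    is used in Pettis' form, which is stable under limits and makes
    t |-> M t (u t) measurable for continuous u (ae_pettis_curve).

    Existence (solution_exists): with the weight w t = exp (2 int_0^t m) one has
    int_0^t m w <= w t / 2, so the Picard map halves the distance
    sup_t |u t - v t| / w t, with no smallness condition on the time interval.

    Bound and uniqueness (energy_bound): along a solution the derivative of |v|^2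
    is 2 Re (M v, v) <= 2 |B| |v|^2, by dissipativity of A.  Hence
    exp (- 2 int_0^t |B|) |v|^2 is absolutely continuous with nonpositive
    derivative almost everywhere, and such a function is nonincreasing
    (real_ac_le).  This gives |v t| <= exp (int_0^t |B|) |v 0|; it is applied to u,
    and to the difference of two solutions.

    If A and B are strongly continuous, uniform boundedness
    (uniform_boundedness) makes M s (u s) continuous in s, and then the
    integral is differentiable at every t (straddle_derivative_near). *)

Local Notation "s *r x" := ((s%:C)%C *: x) (at level 40).

(** * Real norm and real inner product *)

Lemma subr_interchange (V : zmodType) (a b c d : V) :
  (a - b) - (c - d) = (a - c) - (b - d).
Proof. by rewrite !opprB [LHS]addrACA [RHS]addrACA [in RHS](addrC (- c)). Qed.

Section RealNorm.
Variables (R : realType) (H : completeNormedModType R[i]).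
Implicit Types (x y z : H) (s t : R).

Lemma rnormE x : `|x| = ((rnorm x)%:C)%C.
Proof. by rewrite /rnorm RRe_real// ger0_real. Qed.

Lemma rnorm_ge0 x : 0 <= rnorm x.
Proof. by rewrite -lecR -rnormE normr_ge0. Qed.

Lemma rnorm0 : rnorm (0 : H) = 0.
Proof. by rewrite /rnorm normr0. Qed.

Lemma rnormN x : rnorm (- x) = rnorm x.
Proof. by rewrite /rnorm normrN. Qed.

Lemma rdistC x y : rnorm (x - y) = rnorm (y - x).
Proof. by rewrite -opprB rnormN. Qed.

Lemma rnormD x y : rnorm (x + y) <= rnorm x + rnorm y.
Proof. by rewrite -lecR rmorphD /= -!rnormE ler_normD. Qed.

Lemma rnormB x y : rnorm (x - y) <= rnorm x + rnorm y.
Proof. by rewrite -(rnormN y) rnormD. Qed.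

Lemma rdist_triangle z x y : rnorm (x - y) <= rnorm (x - z) + rnorm (z - y).
Proof. by rewrite (le_trans _ (rnormD _ _))// addrA subrK. Qed.

Lemma rnorm_sub_le x y : `|rnorm x - rnorm y| <= rnorm (x - y).
Proof.
have := rnormD (x - y) y; have := rnormD (y - x) x.
by rewrite !subrK (rdistC y) ler_norml => h1 h2; lra.
Qed.

Lemma rnormZ s x : rnorm (s *r x) = `|s| * rnorm x.
Proof.
apply: complexI; rewrite rmorphM/= -!rnormE normrZ; congr (_ * _).
by rewrite normc_def /= expr0n addr0 sqrtr_sqr.
Qed.

Lemma rnorm_eq0 x : rnorm x = 0 -> x = 0.
Proof. by move=> x0; apply/normr0_eq0; rewrite rnormE x0. Qed.

Lemma rscaleDl s t x : (s + t) *r x = s *r x + t *r x.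
Proof. by rewrite rmorphD scalerDl. Qed.

Lemma rscaleNl s x : (- s) *r x = - (s *r x).
Proof. by rewrite rmorphN scaleNr. Qed.

Lemma rscaleBl s t x : (s - t) *r x = s *r x - t *r x.
Proof. by rewrite rscaleDl rscaleNl. Qed.

Lemma rscaleA s t x : s *r (t *r x) = (s * t) *r x.
Proof. by rewrite scalerA rmorphM. Qed.

Lemma rscale1 x : 1 *r x = x.
Proof. by rewrite scale1r. Qed.

(** Norms and radii in H are elements of R[i]; a positive element of R[i] is real,
    so real radii suffice. *)
Lemma rcvgP (T : Type) (F : set_system T) (FF : Filter F) (f : T -> H) (l : H) :
  (f x @[x --> F] --> l) <->
  (forall e : R, 0 < e -> \forall x \near F, rnorm (f x - l) < e).
Proof.
split=> [/cvgrPdistC_lt h e e0|h].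
  have := h (e%:C)%C; rewrite ltcR => /(_ e0).
  by apply: filterS => x; rewrite rnormE ltcR.
apply/cvgrPdistC_lt => e; rewrite ltcE/= => /andP[/eqP e1 e0].
have := h _ e0; apply: filterS => x.
by rewrite rnormE ltcE /= e1 eqxx.
Qed.

End RealNorm.

(** The explicit modulus c also bounds the distance to the limit, which the
    iterations below use quantitatively. *)
Lemma rcauchy_cvg (R : realType) (H : completeNormedModType R[i])
    (x : nat -> H) (c : nat -> R) :
  c n @[n --> \oo] --> 0 ->
  (forall m n, (m <= n)%N -> rnorm (x n - x m) <= c m) ->
  exists2 l, x n @[n --> \oo] --> l & forall m, rnorm (l - x m) <= c m.
Proof.
move=> c0 xc.
have : cvgn x.
  apply/cauchy_cvgP/cauchy_exP => e; rewrite ltcE/= => /andP[/eqP e1 e0].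
  have [N _ /(_ N (leqnn _)) /= cN] := @cvgr0_norm_lt _ _ _ _ _ _ c0 _ e0.
  exists (x N), N => // n /= Nn; rewrite -ball_normE /= rnormE ltcE /= e1 eqxx /=.
  by rewrite rdistC; exact: le_lt_trans (xc _ _ Nn) (le_lt_trans (ler_norm _) cN).
move=> xl; exists (limn x) => // m.
apply/ler_addgt0Pr => e e0.
have /rcvgP/(_ _ e0)[N _ hN] := xl.
have := hN (maxn m N) (leq_maxr _ _) => /= h1.
apply: le_trans (rdist_triangle (x (maxn m N)) _ _) _.
rewrite addrC lerD ?xc ?leq_maxl//.
by rewrite rdistC ltW.
Qed.

Section RealInner.
Variables (R : realType) (H : completeNormedModType R[i]).
Variable (ip : {dot H for Num.conj}).
Hypothesis hilbertH : is_hilbert ip.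
Implicit Types (x y z : H) (s t : R).

(** The real part of ip makes H a real Hilbert space with the same norm; all the
    estimates below are real. *)
Definition rip x y : R := complex.Re (ip x y).

Lemma ripDl x y z : rip (x + y) z = rip x z + rip y z.
Proof. by rewrite /rip linearDl raddfD. Qed.

Lemma ripNl x z : rip (- x) z = - rip x z.
Proof. by rewrite /rip linearNl raddfN. Qed.

Lemma ripBl x y z : rip (x - y) z = rip x z - rip y z.
Proof. by rewrite ripDl ripNl. Qed.

Lemma ripZl s x z : rip (s *r x) z = s * rip x z.
Proof.
rewrite /rip linearZl_LR /=.
by case: (ip x z) => a b /=; rewrite mul0r subr0.
Qed.

Lemma ripC x y : rip x y = rip y x.
Proof.
rewrite /rip hermC expr0 mul1r.
by apply: complexI; rewrite !complexRe Re_conj.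
Qed.

Lemma ripDr x y z : rip z (x + y) = rip z x + rip z y.
Proof. by rewrite !(ripC z) ripDl. Qed.

Lemma ripNr x z : rip z (- x) = - rip z x.
Proof. by rewrite !(ripC z) ripNl. Qed.

Lemma ripZr s x z : rip z (s *r x) = s * rip z x.
Proof. by rewrite !(ripC z) ripZl. Qed.

Lemma ripxx x : rip x x = rnorm x ^+ 2.
Proof.
by rewrite /rip -hilbertH rnormE -rmorphXn.
Qed.

Lemma rnormD_sqr x y :
  rnorm (x + y) ^+ 2 = rnorm x ^+ 2 + 2 * rip x y + rnorm y ^+ 2.
Proof. rewrite -!ripxx ripDl !ripDr (ripC y x); ring. Qed.

Lemma rnormB_sqr x y :
  rnorm (x - y) ^+ 2 = rnorm x ^+ 2 - 2 * rip x y + rnorm y ^+ 2.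
Proof. rewrite rnormD_sqr rnormN ripNr; ring. Qed.

(** Cauchy-Schwarz: expand the square of the norm of |y| x - |x| y. *)
Lemma rip_le x y : rip x y <= rnorm x * rnorm y.
Proof.
have [/rnorm_eq0 ->|x0] := eqVneq (rnorm x) 0.
  by rewrite /rip linear0l rnorm0 mul0r.
have [/rnorm_eq0 ->|y0] := eqVneq (rnorm y) 0.
  by rewrite ripC /rip linear0l rnorm0 mulr0.
have := sqr_ge0 (rnorm (rnorm y *r x - rnorm x *r y)).
rewrite rnormB_sqr ripZl ripZr !rnormZ !ger0_norm ?rnorm_ge0//.
have : 0 < rnorm x * rnorm y.
  by rewrite mulr_gt0// lt_neqAle rnorm_ge0 eq_sym ?x0 ?y0.
set a := rnorm x; set b := rnorm y => ab0 h.
rewrite -subr_ge0 -(@pmulr_rge0 _ (a * b))//.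
nra.
Qed.

Lemma normr_rip_le x y : `|rip x y| <= rnorm x * rnorm y.
Proof.
by rewrite ler_norml rip_le andbT lerNl -ripNr -(rnormN y) rip_le.
Qed.

End RealInner.

(** * Riesz representation *)

Section Riesz.
Variables (R : realType) (H : completeNormedModType R[i]).
Variable (ip : {dot H for Num.conj}).
Hypothesis hilbertH : is_hilbert ip.
Local Notation rip := (rip ip).

(** The representing vector minimises J x = |x|^2 - 2 phi x.  Minimising
    sequences are Cauchy by the parallelogram identity, and at a minimum the
    first variation of J in the direction y, rip z y - phi y, vanishes. *)
Lemma riesz (phi : H -> R) (K : R) :
  (forall x y, phi (x + y) = phi x + phi y) ->
  (forall s x, phi (s *r x) = s * phi x) ->
  (forall x, `|phi x| <= K * rnorm x) ->
  exists z, forall x, rip z x = phi x.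
Proof.
move=> phiD phiZ phiK.
pose J x := rnorm x ^+ 2 - 2 * phi x.
have Jge x : - K ^+ 2 <= J x.
  have := sqr_ge0 (rnorm x - K); have := phiK x; have := ler_norm (phi x).
  rewrite /J; nra.
have hJ : has_inf (range J).
  by split; [exists (J 0), 0|exists (- K ^+ 2) => _ [x _ <-]].
pose m := inf (range J).
have mJ x : m <= J x by apply: ge_inf; [exact: hJ.2|exists x].
have /choice[x xJ] : forall n, exists x, J x < m + n.+1%:R^-1.
  move=> n; have e0 : 0 < n.+1%:R^-1 :> R by rewrite invr_gt0.
  by have [_ [x _ <-] Jx] := inf_adherent e0 hJ; exists x.
(* J is at least m at the midpoint; the parallelogram identity does the rest *)
have para p q : rnorm (p - q) ^+ 2 <= 2 * (J p - m) + 2 * (J q - m).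
  have := mJ (2^-1 *r (p + q)); rewrite /J rnormZ phiZ phiD.
  rewrite gtr0_norm ?invr_gt0// exprMn (rnormD_sqr hilbertH) (rnormB_sqr hilbertH).
  lra.
pose c n : R := Num.sqrt (4 / n.+1%:R).
have c0 : c n @[n --> \oo] --> 0.
  rewrite -sqrtr0; apply: continuous_cvg; first exact: sqrt_continuous.
  rewrite -(mulr0 4); apply: cvgMr => //.
  exact: cvg_harmonic.
have xc i j : (i <= j)%N -> rnorm (x j - x i) <= c i.
  move=> ij; rewrite -(@ger0_norm _ (rnorm _)) ?rnorm_ge0// -sqrtr_sqr ler_sqrt//.
  apply: le_trans (para _ _) _.
  have ji : j.+1%:R^-1 <= i.+1%:R^-1 :> R by rewrite lef_pV2 ?posrE// ler_nat.
  by move: (xJ i) (xJ j) ji; move: (_^-1) (_^-1) => ei ej; lra.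
have [z xz zx] := rcauchy_cvg c0 xc.
have Jz : J z <= m.
  apply/ler_addgt0Pr => e e0.
  pose L := 2 * rnorm z + 1 + 2 * `|K|.
  have L0 : 0 < L by rewrite ltr_pwDl// ltr_pwDr// mulr_ge0// rnorm_ge0.
  pose d := Num.min 1 (e / 2 / L).
  have d0 : 0 < d by rewrite lt_min ltr01 !divr_gt0.
  have /rcvgP/(_ _ d0) near1 := xz.
  have near2 : \forall n \near \oo, n.+1%:R^-1 < e / 2.
    have e20 : 0 < e / 2 by rewrite divr_gt0.
    have [N _ hN] := @cvgr0_norm_lt _ _ _ _ _ _ (@cvg_harmonic R) _ e20.
    by exists N => // n /hN /=; rewrite ger0_norm ?invr_ge0.
  near \oo => n.
  have h1 : rnorm (x n - z) < d by near: n.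
  have h2 : n.+1%:R^-1 < e / 2 by near: n.
  have := xJ n; set w := x n - z in h1 *.
  have -> : x n = z + w by rewrite /w addrC subrK.
  rewrite /J (rnormD_sqr hilbertH) phiD.
  have := normr_rip_le hilbertH z w; rewrite ler_norml => /andP[h3 _].
  have := phiK w; rewrite ler_norml => /andP[_ h4].
  have := h1; rewrite lt_min => /andP[w1 ]; rewrite ltr_pdivlMr// => wL.
  have := sqr_ge0 (rnorm w); have w0 := rnorm_ge0 w.
  have := ler_wpM2r w0 (ler_norm K).
  move: wL; rewrite /L !mulrDr !expr2 => wL h5 h6.
  by move: (_^-1) h2 => en h2 h7; lra.
exists z => y.
apply/eqP; rewrite -subr_eq0; apply/eqP; set g := _ - _.
have hs s : 0 <= 2 * s * g + s ^+ 2 * rnorm y ^+ 2.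
  have := le_trans Jz (mJ (z + s *r y)); rewrite /J phiD phiZ (rnormD_sqr hilbertH).
  rewrite ripZr rnormZ exprMn real_normK ?num_real// /g; lra.
have [y0|y0] := eqVneq (rnorm y) 0.
  have := hs (-1); have := hs 1; rewrite y0; lra.
(* the minimiser over s of the quadratic in hs *)
have := hs (- g / rnorm y ^+ 2).
have -> : 2 * (- g / rnorm y ^+ 2) * g + (- g / rnorm y ^+ 2) ^+ 2 * rnorm y ^+ 2 = - g ^+ 2 / rnorm y ^+ 2.
  by field.
rewrite mulNr oppr_ge0 pmulr_lle0; last first.
  by rewrite invr_gt0 exprn_gt0// lt_neqAle rnorm_ge0 eq_sym y0.
by move=> g2; apply/eqP; rewrite -sqrf_eq0 eq_le g2 sqr_ge0.
Unshelve. all: by end_near. Qed.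

End Riesz.

(** * Absolutely continuous functions *)

Section AbsoluteContinuity.
Variable R : realType.
Local Notation mu := (@lebesgue_measure R).
Implicit Types (T e s t : R) (x y : nat -> R) (f g : R -> R) (D : R -> R -> R).

Definition sorted_itvs T n x y : Prop :=
  (forall i, (i < n)%N -> [/\ 0 <= x i, x i <= y i & y i <= T]) /\
  (forall i, (i.+1 < n)%N -> y i <= x i.+1).

(** Absolute continuity of an abstract increment D s t, so that the same
    domination argument serves scalar functions, curves in H and primitives. *)
Definition small_increments T D : Prop :=
  forall e, 0 < e -> exists2 d : R, 0 < d & forall n x y,
    sorted_itvs T n x y ->
    \sum_(i < n) (y i - x i) < d -> \sum_(i < n) D (x i) (y i) < e.

Definition real_ac T f := small_increments T (fun s t => `|f t - f s|).

Lemma small_increments_dom T (K : R) D1 D2 D : 0 <= K ->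
  small_increments T D1 -> small_increments T D2 ->
  (forall s t, 0 <= s -> s <= t -> t <= T -> D s t <= K * (D1 s t + D2 s t)) ->
  small_increments T D.
Proof.
move=> K0 D1T D2T DK e e0.
have L0 : 0 < K + 1 by rewrite ltr_pwDr.
have eL : 0 < e / (K + 1) / 2 by rewrite !divr_gt0.
have [d1 d10 h1] := D1T _ eL; have [d2 d20 h2] := D2T _ eL.
exists (Num.min d1 d2); first by rewrite lt_min d10.
move=> n x y xy; rewrite lt_min => /andP[/(h1 _ _ _ xy) s1 /(h2 _ _ _ xy) s2].
apply: (@le_lt_trans _ _ (K * (\sum_(i < n) D1 (x i) (y i) + \sum_(i < n) D2 (x i) (y i)))).
  rewrite -big_split mulr_sumr; apply: ler_sum => i _.
  by have [? ? ?] := xy.1 _ (ltn_ord i); exact: DK.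
apply: (@le_lt_trans _ _ (K * (e / (K + 1)))).
  by rewrite ler_wpM2l// [leRHS]splitr lerD// ltW.
by rewrite mulrA ltr_pdivrMr// mulrC ltr_pM2l// ltrDl.
Qed.

Lemma small_increments_pt T D e : small_increments T D -> 0 < e ->
  exists2 d : R, 0 < d & forall s t, 0 <= s -> s <= t -> t <= T ->
    t - s < d -> D s t < e.
Proof.
move=> DT e0; have [d d0 h] := DT _ e0; exists d => // s t s0 st tT tsd.
have := h 1%N (fun=> s) (fun=> t); rewrite !big_ord1; exact.
Qed.

Section Straddle.
Variables (T : R) (f : R -> R) (eps : R) (O : set R).
Hypotheses (T0 : 0 <= T) (eps0 : 0 < eps) (oO : open O).

(** A point is reached when the growth of f up to it, beyond slope eps, is paid
    for by finitely many intervals inside O. *)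
Let reached s := [/\ 0 <= s, s <= T & exists n x y,
  [/\ sorted_itvs s n x y,
      ((\sum_(i < n) (y i - x i))%:E <= mu (O `&` `]0%R, s]))%E &
      f s - f 0 <= eps * s + \sum_(i < n) `|f (y i) - f (x i)|]].

Let reached0 : reached 0.
Proof.
split => //; exists 0%N, (fun=> 0), (fun=> 0); split.
- by split.
- by rewrite big_ord0 measure_ge0.
- by rewrite big_ord0 subrr mulr0 addr0.
Qed.

Let reached_slope s t : reached s -> s <= t -> t <= T ->
  f t - f s <= eps * (t - s) -> reached t.
Proof.
move=> [s0 sT [n [x [y [[xy1 xy2] h1 h2]]]]] st tT fst.
split => //; first exact: le_trans st.
exists n, x, y; split.
- split => // i /xy1[? ? h]; split => //; exact: le_trans st.
- apply: le_trans h1 _; apply: le_measure; rewrite ?inE.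
  + by apply: measurableI => //; exact: open_measurable.
  + by apply: measurableI => //; exact: open_measurable.
  + by apply: setIS => z /=; rewrite !in_itv /= => /andP[-> /le_trans]; exact.
- lra.
Qed.

Let reached_open s t : reached s -> s <= t -> t <= T ->
  `]s, t] `<=` O -> reached t.
Proof.
move=> [s0 sT [n [x [y [[xy1 xy2] h1 h2]]]]] st tT stO.
split => //; first exact: le_trans st.
exists n.+1, (fun i => if (i < n)%N then x i else s),
  (fun i => if (i < n)%N then y i else t); split.
- split => i.
    rewrite ltnS; case: ltnP => [/xy1[? ? h] _|_ _]; split => //.
    exact: le_trans st.
  rewrite ltnS => ni; rewrite ni.
  by case: ltnP => [/xy2//|_]; have [] := xy1 _ ni.
- rewrite big_ord_recr /= ltnn.
  under eq_bigr do rewrite ltn_ord.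
  have -> : O `&` `]0%R, t] = (O `&` `]0%R, s]) `|` `]s, t].
    apply/seteqP; split => z /=; rewrite !in_itv /=.
      move=> [Oz /andP[z0 zt]]; have [zs|zs] := leP z s; last by right; rewrite zt.
      by left; split => //; rewrite z0.
    move=> [[Oz /andP[z0 zt]]|/andP[sz zt]].
      by split => //; rewrite z0 (le_trans zt).
    by split; [apply: stO; rewrite /= in_itv /= sz|rewrite zt (le_lt_trans s0)].
  rewrite measureU//.
  + rewrite EFinD leeD//; have -> // : (t - s)%:E = mu `]s, t].
    rewrite lebesgue_measure_itv /= lte_fin; case: ltP => // ts.
    have -> : t = s by apply/eqP; rewrite eq_le st ts.
    by rewrite subrr.
  + by apply: measurableI => //; exact: open_measurable.
  + rewrite -subset0 => z /= [[_]]; rewrite !in_itv /= => /andP[_ zs].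
    by rewrite ltNge zs.
- rewrite big_ord_recr /= ltnn.
  under eq_bigr do rewrite ltn_ord.
  have := ler_norm (f t - f s); have := ler_wpM2l (ltW eps0) st; lra.
Qed.

(** Cousin's argument: each point has a neighbourhood across which being reached
    propagates, by slope eps off O and by one more interval inside O; so the
    supremum of the reached points is reached and equals T. *)
Lemma straddle_reached :
  (forall t, 0 <= t -> t <= T -> ~ O t -> exists2 d : R, 0 < d & forall s s',
     0 <= s -> t - d < s -> s <= t -> t <= s' -> s' < t + d -> s' <= T ->
     f s' - f s <= eps * (s' - s)) ->
  exists n x y, [/\ sorted_itvs T n x y,
      ((\sum_(i < n) (y i - x i))%:E <= mu O)%E &
      f T - f 0 <= eps * T + \sum_(i < n) `|f (y i) - f (x i)|].
Proof.
move=> fO.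
have local c : 0 <= c -> c <= T -> exists2 d : R, 0 < d & forall s s',
    c - d < s -> s <= c -> c <= s' -> s' < c + d -> s' <= T ->
    reached s -> reached s'.
  move=> c0 cT; have [Oc|nOc] := pselect (O c).
    have /nbhs_ballP[d /= d0 dO] := open_nbhs_nbhs (conj oO Oc).
    exists d => // s s' ds sc cs' s'd s'T rs.
    apply: (reached_open rs) => //; first exact: le_trans cs'.
    move=> z /=; rewrite in_itv /= => /andP[sz zs']; apply: dO.
    rewrite /ball /= ltr_norml; lra.
  have [d d0 dO] := fO _ c0 cT nOc; exists d => // s s' ds sc cs' s'd s'T rs.
  apply: (reached_slope rs) => //; first exact: le_trans cs'.
  by apply: dO => //; case: rs.
have hS : has_sup reached by split; [exists 0|exists T => t []].
pose c := sup reached.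
have c0 : 0 <= c by apply: ub_le_sup => //; exact: hS.2.
have cT : c <= T by apply: ge_sup => [|t []//]; exists 0.
have [d d0 dl] := local _ c0 cT.
have [s rs cs] := sup_adherent d0 hS.
have sc : s <= c by apply: ub_le_sup => //; exact: hS.2.
suff [_ _ [n [x [y [xy h1 h2]]]]] : reached T.
  exists n, x, y; split => //; apply: le_trans h1 _.
  apply: le_measure; rewrite ?inE; last exact: subIsetl.
  - by apply: measurableI => //; exact: open_measurable.
  - exact: open_measurable.
have [Tc|cd] := leP T c.
  have -> : T = c by apply/eqP; rewrite eq_le Tc cT.
  by apply: (dl s) => //; rewrite ltrDl.
pose s' := Num.min T (c + d / 2).
have rs' : reached s'.
  apply: (dl s) => //.
  - by rewrite le_min cT lerDl divr_ge0// ltW.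
  - by rewrite gt_min ltrD2l ltr_pdivrMr// ltr_pMr ?ltr1n ?orbT.
  - by rewrite ge_min lexx.
have : s' <= c by apply: ub_le_sup => //; exact: hS.2.
by rewrite leNgt lt_min cd ltrDl divr_gt0.
Qed.

End Straddle.

(** The exceptional null set is covered by an open set O of small measure; the
    intervals inside O then contribute little by absolute continuity, and the
    rest of [0, T] is crossed with slope at most e.  The condition at t bounds the
    increments over intervals around t, as a nonpositive derivative does. *)
Lemma real_ac_le T f : 0 <= T -> real_ac T f ->
  {ae mu, forall t, 0 < t -> t < T -> forall e, 0 < e ->
     exists2 d : R, 0 < d & forall s s',
     0 <= s -> t - d < s -> s <= t -> t <= s' -> s' < t + d -> s' <= T ->
     f s' - f s <= e * (s' - s)} ->
  f T <= f 0.
Proof.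
move=> T0 acf [N0 [mN0 N00 subN0]].
pose N := N0 `|` [set 0; T].
have mN : measurable N by apply: measurableU => //; apply: measurableU.
have N0' : mu N = 0%E.
  apply/eqP; rewrite -measure_le0 (le_trans (measureU2 _ _ _))//=; last first.
    by rewrite N00 add0e (le_trans (measureU2 _ _ _))//= !lebesgue_measure_set1 adde0.
  exact: measurableU.
apply/ler_addgt0Pr => e e0.
pose eps := e / 2 / (T + 1).
have T1 : 0 < T + 1 by rewrite ltr_wpDl.
have eps0 : 0 < eps by rewrite !divr_gt0.
have [d d0 hd] := acf _ (divr_gt0 e0 (ltr0n R 2)).
have [|O [oO NO Od]] := @lebesgue_regularity_outer R N d mN _ d0.
  by change (mu N < +oo)%E; rewrite N0' ltry.
have mO : (mu O < d%:E)%E.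
  have mO' : measurable O by exact: open_measurable.
  have -> : O = (O `\` N) `|` N by rewrite setUC setDUK.
  rewrite measureU//; [|exact: measurableD|by rewrite setDKI].
  by have <- : ((mu (O `\` N) + 0 = mu (O `\` N) + mu N))%E; rewrite ?N0' ?adde0.
have [t t0 tT nOt|n [x [y [xy h1 h2]]]] := @straddle_reached T f eps O T0 eps0 oO.
  have nNt : ~ N t by move/NO.
  have {}t0 : 0 < t.
    rewrite lt_neqAle t0 andbT; apply/eqP => t0'; apply: nNt.
    by right; left.
  have {}tT : t < T.
    by rewrite lt_neqAle tT andbT; apply/eqP => t0'; apply: nNt; right; right.
  apply: contrapT => h; apply: nNt; left; apply: subN0 => /= h'.
  exact/h/h'.
have s1 : \sum_(i < n) (y i - x i) < d by rewrite -lte_fin (le_lt_trans h1).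
have := hd _ _ _ xy s1.
have : eps * T <= e / 2.
  by rewrite /eps mulrAC ler_pdivrMr// ler_wpM2l ?divr_ge0 ?lerDl// ltW.
lra.
Qed.

End AbsoluteContinuity.

(** * Primitives of locally integrable functions *)

Section Primitive.
Variable R : realType.
Local Notation mu := (@lebesgue_measure R).
Local Notation locint := (@locally_integrable R setT).
Implicit Types (s t e : R) (f g : R -> R).

Lemma aeS (P Q : R -> Prop) : (forall t, P t -> Q t) ->
  {ae mu, forall t, P t} -> {ae mu, forall t, Q t}.
Proof. exact: (@filterS _ _ (ae_filter_ringOfSetsType mu)). Qed.

Lemma aeS2 (P Q S : R -> Prop) : (forall t, P t -> Q t -> S t) ->
  {ae mu, forall t, P t} -> {ae mu, forall t, Q t} -> {ae mu, forall t, S t}.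
Proof. exact: (@filterS2 _ _ (ae_filter_ringOfSetsType mu)). Qed.

Lemma lebesgue_itvoc s t : s <= t -> mu `]s, t] = (t - s)%:E.
Proof.
move=> st; rewrite lebesgue_measure_itv /= lte_fin; case: ltP => // ts.
have -> : t = s by apply/eqP; rewrite eq_le st ts.
by rewrite subrr.
Qed.

Lemma locint_measurable g : locint g -> measurable_fun setT g.
Proof. by case. Qed.

Lemma locint_itvcc g s t : locint g -> mu.-integrable `[s, t] (EFin \o g).
Proof.
move=> [mg _ h]; apply/integrableP; split.
  by apply/measurable_EFinP; exact: measurable_funTS.
by apply: h => //; exact: segment_compact.
Qed.

Lemma locint_itvoc g s t : locint g -> mu.-integrable `]s, t] (EFin \o g).
Proof.
move=> /(locint_itvcc s t); apply: integrableS => //.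
by apply: subset_itvr; rewrite bnd_simp.
Qed.

(** A compact set lies in some segment [- M, M]. *)
Lemma locintP g : measurable_fun setT g ->
  (forall M, 0 < M -> mu.-integrable `[- M, M] (EFin \o g)) -> locint g.
Proof.
move=> mg h; split => //; first exact: openT.
move=> K _ cK; have [M [Mr bM]] := compact_bounded cK.
pose M1 := `|M| + 1.
have M10 : 0 < M1 by rewrite ltr_pwDr.
have KM : K `<=` `[- M1, M1].
  move=> x Kx /=; rewrite in_itv /= -ler_norml.
  by apply: bM => //; rewrite /M1 ltr_pwDr// ler_norm.
have /integrableP[_] := h _ M10; apply: le_lt_trans.
apply: ge0_subset_integral => //=; first exact: compact_measurable.
apply/measurable_EFinP; apply: measurableT_comp => //.
exact: measurable_funTS.
Qed.

Lemma locint_norm g : locint g -> locint (fun t => `|g t|).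
Proof.
move=> lg; apply: locintP => [|M M0].
  by apply: measurableT_comp => //; exact: locint_measurable.
exact/integrable_norm/locint_itvcc.
Qed.

Lemma locint_le f g : measurable_fun setT f -> (forall t, `|f t| <= g t) ->
  locint g -> locint f.
Proof.
move=> mf fg lg; apply: locintP => // M M0.
apply: le_integrable (locint_itvcc (- M) M lg) => //.
  by apply/measurable_EFinP; exact: measurable_funTS.
by move=> t _ /=; rewrite lee_fin (le_trans (fg _))// ler_norm.
Qed.

Lemma locint_cst c : locint (cst c).
Proof.
apply: locintP => // M M0.
apply: measurable_bounded_integrable => //.
  suff: (mu `[(- M)%R, M]%classic < +oo)%E by [].
  by rewrite lebesgue_measure_itv /=; case: ifP => _; rewrite ltry.
exists `|c|; split => [|x cx t _ /=]; [exact: num_real|exact: ltW].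
Qed.

(** On a bounded interval a nondecreasing weight is bounded, so it preserves
    local integrability. *)
Lemma locint_weight g q : locint g -> (forall t, 0 <= g t) ->
  (forall t, 0 <= q t) -> {homo q : s t / s <= t} -> locint (fun t => g t * q t).
Proof.
move=> lg g0 q0 qi.
have mgq : measurable_fun setT (fun t => g t * q t).
  apply: measurable_funM; first exact: locint_measurable.
  exact: nondecreasing_measurable.
apply: locintP => // M M0.
have iM : mu.-integrable `[- M, M] (fun t => (q M)%:E * (g t)%:E)%E.
  by apply: integrableZl => //; exact: locint_itvcc.
apply: le_integrable iM => //.
- by apply/measurable_EFinP; exact: measurable_funTS.
- move=> t /=; rewrite in_itv /= => /andP[_ tM].
  rewrite lee_fin !ger0_norm ?mulr_ge0// mulrC ler_wpM2r//.
  exact: qi.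
Qed.

Definition primitive g t := \int[mu]_(x in `]0, t]) g x.

Lemma primitiveB g s t : locint g -> 0 <= s -> s <= t ->
  primitive g t - primitive g s = \int[mu]_(x in `]s, t]) g x.
Proof.
move=> lg s0 st; rewrite /primitive Rintegral_itvB//; first exact: locint_itvoc.
Qed.

Lemma primitive0 g : primitive g 0 = 0.
Proof. by rewrite /primitive set_itvoc0 Rintegral_set0. Qed.

Lemma primitive_homo g s t : locint g -> (forall t, 0 <= g t) -> s <= t ->
  primitive g s <= primitive g t.
Proof.
move=> lg g0 st; have [s0|s0] := leP 0 s.
  by rewrite -subr_ge0 primitiveB//; apply: Rintegral_ge0.
rewrite {1}/primitive set_itv_ge ?Rintegral_set0; last by rewrite bnd_simp -leNgt ltW.
exact: Rintegral_ge0.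
Qed.

Lemma primitive_ge0 g t : (forall t, 0 <= g t) -> 0 <= primitive g t.
Proof. by move=> g0; exact: Rintegral_ge0. Qed.

Lemma le_Rintegral_itv f g s t : locint f -> locint g ->
  (forall x, s < x -> x <= t -> f x <= g x) ->
  \int[mu]_(x in `]s, t]) f x <= \int[mu]_(x in `]s, t]) g x.
Proof.
move=> lf lg fg; apply: le_Rintegral => //; try exact: locint_itvoc.
by move=> x /=; rewrite in_itv /= => /andP[/fg]; exact.
Qed.

(** Replacing f by min f g changes it on a null set only and makes the comparison
    hold everywhere. *)
Lemma ae_le_Rintegral_itv f g s t : locint f -> locint g ->
  {ae mu, forall x, s < x -> x <= t -> f x <= g x} ->
  \int[mu]_(x in `]s, t]) f x <= \int[mu]_(x in `]s, t]) g x.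
Proof.
move=> lf lg fg.
have lm : locint (f \min g).
  apply: (@locint_le _ (fun t => `|f t| + `|g t|)).
  - by apply: measurable_minr; exact: locint_measurable.
  - move=> x /=; rewrite /Num.min; case: ifP => _.
      by rewrite ler_wpDr.
    by rewrite ler_wpDl.
  - by apply: locally_integrableD; exact: locint_norm.
rewrite (_ : \int[mu]_(x in _) f x = \int[mu]_(x in `]s, t]) (f \min g) x); last first.
  congr fine; apply: ae_eq_integral => //.
  - by apply/measurable_EFinP/measurable_funTS; exact: locint_measurable.
  - by apply/measurable_EFinP/measurable_funTS; exact: locint_measurable.
  - move: fg; apply: aeS => x h /=; rewrite in_itv /= => /andP[sx xt].
    by rewrite min_l// h.
by apply: le_Rintegral_itv => // x _ _; rewrite ge_min lexx orbT.
Qed.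

Lemma Rintegral_itv_cst c s t : s <= t -> \int[mu]_(x in `]s, t]) c = c * (t - s).
Proof.
move=> st; rewrite Rintegral_cst//; congr (_ * _).
by change (fine (mu `]s, t]) = t - s); rewrite lebesgue_itvoc.
Qed.

(** The sum of the increments over disjoint intervals is the integral over their
    union, which is small when the union has small measure. *)
Lemma small_increments_primitive T g : locint g -> (forall t, 0 <= g t) ->
  small_increments T (fun s t => primitive g t - primitive g s).
Proof.
move=> lg g0 e e0.
pose gT := g \_ `[0, T].
have igT : mu.-integrable setT (EFin \o gT).
  have -> : EFin \o gT = (EFin \o g) \_ `[0, T].
    by rewrite restrict_EFin.
  by rewrite -integrable_mkcond//; exact: locint_itvcc.
have [d [d0 hd]] := integral_normr_continuous igT e0.
exists d => // n x y [xy1 xy2] xyd.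
have [A [mA AT An muA intA]] : exists A : set R, [/\ measurable A, A `<=` `[0, T],
    forall z, A z -> exists2 i, (i < n)%N & z <= y i,
    mu A = (\sum_(i < n) (y i - x i))%:E &
    \int[mu]_(z in A) g z = \sum_(i < n) (primitive g (y i) - primitive g (x i))].
  elim: n xy1 xy2 {xyd} => [|n IHn] xy1 xy2.
    exists set0; split => //; rewrite ?big_ord0 ?measure0 ?Rintegral_set0//.
  have [|i ni|A [mA AT An muA intA]] := IHn.
  - by move=> i ni; apply: xy1; rewrite ltnS ltnW.
  - by apply: xy2; rewrite ltnS ltnW.
  have [x0 xy yT] := xy1 n (leqnn _).
  have disj : A `&` `]x n, y n] = set0.
    rewrite -subset0 => z /= [/An[i ni zi]]; rewrite in_itv /= => /andP[xz _].
    have yx j : (j < n)%N -> y j <= x n.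
      have : (n < n.+1)%N by []; elim: {-2}n j => // m IHm j mn.
      rewrite ltnS leq_eqVlt => /predU1P[->|jm]; first exact: xy2.
      have [_ xm _] := xy1 _ (ltnW mn).
      exact: le_trans (IHm _ (ltnW mn) jm) (le_trans xm (xy2 _ mn)).
    by have := le_lt_trans (le_trans zi (yx _ ni)) xz; rewrite ltxx.
  have sub : A `|` `]x n, y n] `<=` `[0, T].
    rewrite subUset; split => // z /=; rewrite !in_itv /= => /andP[xz zy].
    by rewrite (le_trans zy)// andbT ltW// (le_lt_trans x0).
  exists (A `|` `]x n, y n]); split => //.
  - exact: measurableU.
  - move=> z [/An[i ni zi]|/=]; first by exists i => //; rewrite ltnS ltnW.
    by rewrite in_itv /= => /andP[_ zy]; exists n.
  - rewrite measureU// big_ord_recr /= EFinD -muA; congr (_ + _)%E.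
    exact: lebesgue_itvoc.
  - rewrite Rintegral_setU//.
    + by rewrite big_ord_recr /= -intA primitiveB.
    + by apply: integrableS (locint_itvcc 0 T lg) => //; exact: measurableU.
    + by apply/disj_setPS; rewrite disj.
have muAd : (mu A < d%:E)%E by rewrite muA lte_fin.
rewrite -intA; apply: le_lt_trans (hd _ mA muAd).
rewrite le_eqVlt; apply/orP; left; apply/eqP.
apply: eq_Rintegral => z; rewrite inE => Az.
by rewrite /gT patchE mem_set ?ger0_norm//; exact: AT.
Qed.

Lemma ae_is_derive_primitive g : locint g ->
  {ae mu, forall t, 0 < t -> is_derive t 1 (primitive g) (g t)}.
Proof.
move=> lg; apply: aeS (lebesgue_differentiation lg) => t lt t0.
have t1 : t < t + 1 by rewrite ltrDl.
have i1 : mu.-integrable [set` Interval (BRight 0) (BRight (t + 1))] (EFin \o g).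
  exact: locint_itvoc.
have at0 : (BRight (0 : R) < BRight t)%O by rewrite bnd_simp.
have [dF F'] := FTC1_lebesgue_pt t1 i1 at0 lt.
apply: DeriveDef => //.
by rewrite -derive1E.
Qed.

(** An interval ]s, s'] around t need not be centred at t, but it sits in the ball
    of radius 2 (s' - s), whose measure is only 4 times as large. *)
Lemma lebesgue_pt_average g t e : locint g -> lebesgue_pt g t -> 0 < e ->
  exists2 d : R, 0 < d & forall s s', t - d < s -> s <= t -> t <= s' -> s' < t + d ->
    \int[mu]_(x in `]s, s']) g x <= (g t + e) * (s' - s).
Proof.
move=> lg lt e0.
have e4 : 0 < e / 4 by rewrite divr_gt0.
move: lt => /fine_cvgP[_ /cvgr0_norm_lt/(_ _ e4)[d /= d0 hd]].
exists (d / 4); first by rewrite divr_gt0.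
move=> s s' ds st ts' s'd.
have ss' : s <= s' by exact: le_trans ts'.
have [->|ss'0] := eqVneq s s'.
  by rewrite set_itvoc0 Rintegral_set0 subrr mulr0.
pose r := 2 * (s' - s).
have r0 : 0 < r by rewrite mulr_gt0// subr_gt0 lt_neqAle ss'0.
have lgt : locint (fun x => g x - g t).
  apply: locally_integrableB => //; exact: locint_cst.
have lgtn := locint_norm lgt.
have ib : mu.-integrable (ball t r) (EFin \o (fun x => `|g x - g t|)).
  apply: integrableS (locint_itvcc (t - r) (t + r) lgtn) => //.
    exact: measurable_ball.
  by move=> x; rewrite /ball /= in_itv /= ltr_norml => /andP[h1 h2]; lra.
pose I := \int[mu]_(x in ball t r) `|g x - g t|.
have I0 : 0 <= I by exact: Rintegral_ge0.
have hI : I <= e * (s' - s).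
  have /= := hd r; rewrite sub0r normrN gtr0_norm// => /(_ _ r0).
  have rd : r < d by rewrite /r; lra.
  move=> /(_ rd); rewrite /davg /iavg.
  rewrite (_ : (\int[mu]_(y in _) _)%E = I%:E); last first.
    rewrite /I /Rintegral fineK; first by [].
    by apply: integrable_fin_num => //; exact: measurable_ball.
  rewrite [X in (X^-1)%E](_ : _ = (r *+ 2)%:E); last first.
    exact/lebesgue_measure_ball/ltW.
  rewrite inver mulrn_eq0 /= gt_eqF//=.
  rewrite ger0_norm; last by rewrite mulr_ge0// invr_ge0 mulrn_wge0// ltW.
  rewrite [_ * I]mulrC ltr_pdivrMr; last by rewrite pmulrn_lgt0.
  rewrite -mulr_natr /r; lra.
apply: le_trans (_ : I + g t * (s' - s) <= _); last by rewrite mulrDl addrC lerD2l.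
rewrite -(Rintegral_itv_cst _ ss') -lerBlDr -RintegralB//; [|exact: locint_itvoc|].
  apply: le_trans (_ : \int[mu]_(x in `]s, s']) `|g x - g t| <= _).
    by apply: le_Rintegral_itv => // x _ _; exact: ler_norm.
  rewrite /Rintegral fine_le//.
  - by apply: integrable_fin_num => //; exact: locint_itvoc.
  - by apply: integrable_fin_num => //; exact: measurable_ball.
  - apply: ge0_subset_integral => //.
    + exact: measurable_ball.
    + by apply/measurable_EFinP/measurable_funTS; exact: locint_measurable lgtn.
    + move=> x /=; rewrite in_itv /= /ball /= ltr_norml /r => /andP[h1 h2]; lra.
exact: locint_itvoc (locint_cst _).
Qed.

End Primitive.

(** * Pettis measurability *)

Section PettisMeasurability.
Variables (R : realType) (H : completeNormedModType R[i]).
Local Notation mu := (@lebesgue_measure R).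
Local Notation mR := (measurableTypeR R).
Implicit Types (f g : R -> H) (D N : set R).

(** Separable range and Borel distances to all points: unlike approximation by
    simple functions, this form passes to pointwise limits at once. *)
Definition pettis_measurable f : Prop :=
  (exists y : nat -> H, forall t e, 0 < e -> exists k, rnorm (f t - y k) < e) /\
  (forall x, measurable_fun setT (fun t => rnorm (f t - x))).

Lemma pettis_simple g : simple_fun g -> pettis_measurable g.
Proof.
move=> [fg mg]; split.
  have /finite_seqP[s sE] := fg.
  exists (fun k => nth 0 s k) => t e e0.
  have : range g (g t) by exists t.
  by rewrite sE => /(nthP 0)[i _ <-]; exists i; rewrite subrr rnorm0.
move=> x _ Y mY; rewrite setTI.
rewrite (_ : _ @^-1` Y = \bigcup_(y in range g `&` [set y | Y (rnorm (y - x))])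
    (g @^-1` [set y])).
  apply: fin_bigcup_measurable => [|y _]; [exact: finite_setIl|exact: mg].
apply/seteqP; split => [t /= Yt|t [y [_ /= Yy]] /= ->//].
by exists (g t) => //; split => //; exists t.
Qed.

Lemma pettis_cvg (f : nat -> R -> H) g : (forall n, pettis_measurable (f n)) ->
  (forall t, f n t @[n --> \oo] --> g t) -> pettis_measurable g.
Proof.
move=> pf fg; split.
  have /choice[y yP] n := (pf n).1.
  pose yy k := if @unpickle (nat * nat)%type k is Some nm then y nm.1 nm.2 else 0.
  exists yy => t e e0; have e20 : 0 < e / 2 by rewrite divr_gt0.
  have /rcvgP/(_ _ e20)[n _ /(_ n (leqnn _)) /= fng] := fg t.
  have [m ym] := yP n t _ e20.
  exists (pickle (n, m)); rewrite /yy pickleK /= (splitr e).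
  by rewrite (le_lt_trans (rdist_triangle (f n t) _ _))// ltrD// rdistC.
move=> x; apply: (@measurable_fun_cvg _ _ _ _ (fun n t => rnorm (f n t - x))).
  by move=> n; exact: (pf n).2.
move=> t _; apply/cvgrPdist_lt => e e0.
have /rcvgP/(_ _ e0) := fg t; apply: filterS => n; apply: le_lt_trans.
rewrite distrC; apply: le_trans (rnorm_sub_le _ _) _.
by rewrite opprB addrA subrK.
Qed.

(** Serves to change a function on a measurable set and to freeze a curve along a
    grid of times. *)
Lemma pettis_glue (k : R -> nat) (F : nat -> R -> H) :
  (forall i, measurable (k @^-1` [set i] : set mR)) ->
  (forall i, pettis_measurable (F i)) -> pettis_measurable (fun t => F (k t) t).
Proof.
move=> mk pF; split.
  have /choice[y yP] n := (pF n).1.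
  pose yy k := if @unpickle (nat * nat)%type k is Some nm then y nm.1 nm.2 else 0.
  exists yy => t e e0; have [m ym] := yP (k t) t _ e0.
  by exists (pickle (k t, m)); rewrite /yy pickleK.
move=> x _ Y mY; rewrite setTI.
rewrite (_ : _ @^-1` Y = \bigcup_i
    (k @^-1` [set i] `&` (fun t => rnorm (F i t - x)) @^-1` Y)).
  apply: bigcupT_measurable => i; apply: measurableI; first exact: mk.
  by rewrite -[X in measurable X]setTI; exact: (pF i).2.
apply/seteqP; split => [t /= Yt|t [i _ [/= ->]]//].
by exists (k t).
Qed.

Lemma pettis_cst (x : H) : pettis_measurable (fun=> x).
Proof.
split; first by exists (fun=> x) => t e e0; exists 0%N; rewrite subrr rnorm0.
by move=> y; exact: measurable_cst.
Qed.

Definition zero_outside D f t := if t \in D then f t else 0.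

Lemma pettis_zero_outside D f : measurable (D : set mR) ->
  pettis_measurable f -> pettis_measurable (zero_outside D f).
Proof.
move=> mD pf.
pose k t : nat := if t \in D then 0%N else 1%N.
rewrite (_ : zero_outside D f = fun t => (if k t is 0%N then f else cst 0) t); last first.
  by apply/funext => t; rewrite /zero_outside /k; case: ifP.
apply: (@pettis_glue k (fun i => if i is 0%N then f else cst 0)); last first.
  by case=> // n; exact: pettis_cst.
case=> [|[|n]].
- rewrite (_ : _ @^-1` _ = D)//; apply/seteqP; split => t; rewrite /k /=.
    by case: ifPn => // /set_mem.
  by move=> Dt; rewrite mem_set.
- rewrite (_ : _ @^-1` _ = ~` D); first exact: measurableC.
  apply/seteqP; split => t; rewrite /k /=.
    by case: ifPn => // /negP tD _ /mem_set.
  by move=> Dt; rewrite memNset.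
- rewrite (_ : _ @^-1` _ = set0)//; apply/seteqP; split => t //=; rewrite /k.
  by case: ifP.
Qed.

(** By polarisation, inner products are measurable as soon as distances are. *)
Lemma pettis_rip (ip : {dot H for Num.conj}) (hilbertH : is_hilbert ip) f x :
  pettis_measurable f -> measurable_fun setT (fun t => rip ip (f t) x).
Proof.
move=> [_ mf].
rewrite (_ : (fun t => _) = (fun t =>
   2^-1 * ((rnorm (f t - 0) ^+ 2 + rnorm x ^+ 2) - rnorm (f t - x) ^+ 2))); last first.
  by apply/funext => t; rewrite subr0 (rnormB_sqr hilbertH); field.
apply: measurable_funM => //; apply: measurable_funB.
  by apply: measurable_funD => //; apply: measurable_funX; exact: mf.
by apply: measurable_funX; exact: mf.
Qed.

(** A Lebesgue measurable f agrees only almost everywhere with a Borel function.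
    Since f' is 0 where it differs from f, it obeys everywhere each norm bound
    that f obeys for nonnegative times. *)
Definition version f f' : Prop :=
  [/\ pettis_measurable f', forall t, f' t = f t \/ f' t = 0, forall t, t < 0 -> f' t = 0 &
      {ae mu, forall t, 0 <= t -> f' t = f t}].

Definition ae_pettis_measurable f : Prop := exists f', version f f'.

Lemma ae_pettis_cvg (f : nat -> R -> H) g : (forall n, ae_pettis_measurable (f n)) ->
  {ae mu, forall t, 0 <= t -> f n t @[n --> \oo] --> g t} -> ae_pettis_measurable g.
Proof.
move=> /choice[f' f'P] fg.
have [N [mN N0 subN]] : {ae mu, forall t, 0 <= t ->
    (forall n, f' n t = f n t) /\ f n t @[n --> \oo] --> g t}.
  have := ae_foralln (fun n => let: And4 _ _ _ h := f'P n in h).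
  move: fg; apply: aeS2 => t ft f't t0; split; last exact: ft.
  by move=> n; exact: f't.
pose D := `[0, +oo[ `\` N.
have mD : measurable (D : set mR) by apply: measurableD.
exists (zero_outside D g); split.
- apply: (@pettis_cvg (fun n => zero_outside D (f' n))).
    by move=> n; apply: pettis_zero_outside => //; have [] := f'P n.
  move=> t; rewrite /zero_outside; case: ifPn; last by move=> _; exact: cvg_cst.
  rewrite inE => -[]; rewrite /= in_itv /= andbT => t0 Nt.
  have [] := contrapT (fun h => Nt (subN t h)); first by [].
  by move=> /funext <-.
- by move=> t; rewrite /zero_outside; case: ifP => _; [left|right].
- move=> t t0; rewrite /zero_outside memNset// => -[].
  by rewrite /= in_itv /= andbT leNgt t0.
- exists N; split => // t /= h; apply: contrapT => Nt; apply: h => t0.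
  by rewrite /zero_outside mem_set//; split => //=; rewrite in_itv /= t0.
Qed.

Lemma ae_pettis_simple g : simple_fun g -> ae_pettis_measurable g.
Proof.
move=> sg; exists (zero_outside `[0, +oo[ g); split.
- by apply: pettis_zero_outside => //; exact: pettis_simple.
- by move=> t; rewrite /zero_outside; case: ifP => _; [left|right].
- by move=> t t0; rewrite /zero_outside memNset//= in_itv /= andbT leNgt t0.
- by apply: aeW => t t0; rewrite /zero_outside mem_set//= in_itv /= t0.
Qed.

(** The fibre of f + g over z is the finite union, over the values y of g, of
    sets where g = y and f = z - y. *)
Lemma simple_funD f g : simple_fun f -> simple_fun g ->
  simple_fun (fun t => f t + g t).
Proof.
move=> [ff mf] [fg mg]; split.
  apply: sub_finite_set (finite_image2 (fun x y => x + y) ff fg).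
  by move=> _ [t _ <-]; exists (f t); [exists t|exists (g t) => //; exists t].
move=> z; rewrite (_ : _ @^-1` _ =
    \bigcup_(y in range g) (g @^-1` [set y] `&` f @^-1` [set z - y])).
  by apply: fin_bigcup_measurable => // y _; apply: measurableI.
apply/seteqP; split => [t /= <-|t [y _] /= [-> ->]]; last by rewrite subrK.
by exists (g t); [exists t|rewrite addrK].
Qed.

Lemma ae_pettis_stronglyD f g : strongly_measurable f -> strongly_measurable g ->
  ae_pettis_measurable (fun t => f t + g t).
Proof.
move=> [p sp pf] [q sq qg].
apply: (@ae_pettis_cvg (fun n t => p n t + q n t)).
  by move=> n; apply/ae_pettis_simple/simple_funD.
move: pf qg; apply: aeS2 => t pt qt t0; apply: cvgD; [exact: pt|exact: qt].
Qed.

Lemma ae_pettis_glue (k : R -> nat) (F : nat -> R -> H) :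
  (forall i, measurable (k @^-1` [set i] : set mR)) ->
  (forall i, ae_pettis_measurable (F i)) -> ae_pettis_measurable (fun t => F (k t) t).
Proof.
move=> mk /choice[F' F'P]; exists (fun t => F' (k t) t); split.
- by apply: pettis_glue => // i; have [] := F'P i.
- by move=> t; have [] := F'P (k t).
- by move=> t; have [_ _ h _] := F'P (k t); exact: h.
- have := ae_foralln (fun n => let: And4 _ _ _ h := F'P n in h).
  by apply: aeS => t h t0; exact: h.
Qed.

Definition nonneg_continuous f : Prop := forall t, 0 <= t -> forall e : R, 0 < e ->
  exists2 d : R, 0 < d & forall s, 0 <= s -> `|s - t| < d -> rnorm (f s - f t) < e.

(** A continuous curve is the limit of curves constant on intervals of length
    1 / (n + 1), along which the operators act on one fixed vector at a time. *)
Lemma ae_pettis_curve (M : R -> H -> H) (m : R -> R) (u : R -> H) :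
  (forall x, ae_pettis_measurable (fun t => M t x)) ->
  (forall t x y, 0 <= t -> rnorm (M t x - M t y) <= m t * rnorm (x - y)) ->
  nonneg_continuous u -> ae_pettis_measurable (fun t => M t (u t)).
Proof.
move=> pM Mm cu.
pose k n (t : R) := Num.trunc (t * n.+1%:R).
apply: (@ae_pettis_cvg (fun n t => M t (u ((k n t)%:R / n.+1%:R)))).
  move=> n; apply: (@ae_pettis_glue (k n) (fun i t => M t (u (i%:R / n.+1%:R)))) => // i.
  apply: is_interval_measurable => s t /= ks kt z /andP[sz zt].
  have n0 : 0 <= n.+1%:R :> R by [].
  apply/eqP; rewrite eqn_leq; apply/andP; split.
    by rewrite -kt; apply: le_truncn; rewrite ler_wpM2r.
  by rewrite -ks; apply: le_truncn; rewrite ler_wpM2r.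
apply: aeW => t t0; apply/rcvgP => e e0.
have m0 : 0 < `|m t| + 1 by rewrite ltr_pwDr.
have [d d0 ud] := cu _ t0 _ (divr_gt0 e0 m0).
have [N _ hN] := @cvgr0_norm_lt _ _ _ _ _ _ (@cvg_harmonic R) _ d0.
exists N => // n /hN /=; rewrite ger0_norm ?invr_ge0// => nd.
have n0 : 0 < n.+1%:R :> R by [].
have /andP[k1 k2] : (k n t)%:R <= t * n.+1%:R < (k n t).+1%:R.
  by apply: truncn_itv; rewrite mulr_ge0.
apply: le_lt_trans (Mm _ _ _ t0) _.
have ltd : rnorm (u ((k n t)%:R / n.+1%:R) - u t) < e / (`|m t| + 1).
  apply: ud; first by rewrite divr_ge0.
  rewrite ler0_norm ?subr_le0 ?ler_pdivrMr// opprB.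
  apply: le_lt_trans nd.
  rewrite lerBlDr -[X in _ <= X + _]mul1r -mulrDl ler_pdivlMr//.
  by rewrite addrC natr1 ltW.
apply: (@le_lt_trans _ _ (`|m t| * (e / (`|m t| + 1)))).
  apply: (@le_trans _ _ (`|m t| * rnorm (u ((k n t)%:R / n.+1%:R) - u t))).
    by rewrite ler_wpM2r ?rnorm_ge0// ler_norm.
  by rewrite ler_wpM2l// ltW.
by rewrite mulrA ltr_pdivrMr// mulrC ltr_pM2l// ltrDl.
Qed.

End PettisMeasurability.

(** * Weak integrals *)

Section WeakIntegral.
Variables (R : realType) (H : completeNormedModType R[i]).
Variable (ip : {dot H for Num.conj}).
Hypothesis hilbertH : is_hilbert ip.
Local Notation rip := (rip ip).
Local Notation mu := (@lebesgue_measure R).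
Local Notation locint := (@locally_integrable R setT).
Implicit Types (f U V : R -> H) (g h : R -> R) (x y : H) (s t : R).

Definition bochner_integrable f := pettis_measurable f /\ locint (fun t => rnorm (f t)).

Lemma bochner_le f g : pettis_measurable f -> (forall t, rnorm (f t) <= g t) -> locint g ->
  bochner_integrable f.
Proof.
move=> pf fg lg; split => //; apply: locint_le lg.
  rewrite (_ : (fun t => _) = (fun t => rnorm (f t - 0))); first exact: pf.2.
  by apply/funext => t; rewrite subr0.
by move=> t; rewrite ger0_norm ?rnorm_ge0.
Qed.

Lemma bochner_dist f y : bochner_integrable f -> locint (fun t => rnorm (f t - y)).
Proof.
move=> [pf lf]; apply: (@locint_le _ _ (fun t => rnorm (f t) + rnorm y)).
- exact: pf.2.
- by move=> t; rewrite ger0_norm ?rnorm_ge0// rnormB.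
- by apply: locally_integrableD => //; exact: locint_cst.
Qed.

Lemma bochner_cst y : bochner_integrable (cst y).
Proof. split; [exact: pettis_cst|exact: (locint_cst (rnorm y))]. Qed.

Lemma locintZ g (c : R) : locint g -> (forall t, 0 <= g t) -> 0 <= c ->
  locint (fun t => g t * c).
Proof. by move=> lg g0 c0; apply: (@locint_weight _ g (cst c)). Qed.

Lemma locintZl g (c : R) : locint g -> (forall t, 0 <= g t) -> 0 <= c ->
  locint (fun t => c * g t).
Proof.
move=> lg g0 c0; rewrite (_ : (fun t => _) = (fun t => g t * c)).
  exact: locintZ.
by apply/funext => t; rewrite mulrC.
Qed.

Lemma bochner_rip f x : bochner_integrable f -> locint (fun t => rip (f t) x).
Proof.
move=> [pf lf].
apply: (@locint_le _ _ (fun t => rnorm (f t) * rnorm x)).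
- exact: pettis_rip.
- by move=> t; exact: normr_rip_le.
- by apply: locintZ => // [t|]; rewrite rnorm_ge0.
Qed.

(** Prescribing increments leaves the initial value of U free and makes the
    estimates below local in time. *)
Definition weak_primitive f U := forall s t, 0 <= s -> s <= t ->
  forall x, rip (U t - U s) x = \int[mu]_(r in `]s, t]) rip (f r) x.

Lemma weak_primitive_exists f u0 : bochner_integrable f ->
  exists2 U, weak_primitive f U & U 0 = u0.
Proof.
move=> bf.
have /choice[z zP] t : exists z, forall x, rip z x = primitive (fun r => rip (f r) x) t.
  apply: (riesz hilbertH (K := primitive (fun r => rnorm (f r)) t)).
  - move=> x y; rewrite /primitive.
    rewrite -RintegralD//; try by apply: locint_itvoc; exact: bochner_rip.
    by apply: eq_Rintegral => r _; rewrite ripDr.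
  - move=> c x; rewrite /primitive.
    rewrite -RintegralZl//; last by apply: locint_itvoc; exact: bochner_rip.
    by apply: eq_Rintegral => r _; rewrite ripZr.
  - move=> x; rewrite /primitive -RintegralZr//; last by apply: locint_itvoc; case: bf.
    apply: le_trans (le_normr_Rintegral _ _) _ => //.
      by apply: locint_itvoc; exact: bochner_rip.
    apply: le_Rintegral_itv.
    + by apply: locint_norm; exact: bochner_rip.
    + by apply: locintZ => [|r|]; rewrite ?rnorm_ge0//; case: bf.
    + by move=> r _ _; exact: normr_rip_le.
exists (fun t => u0 + z t).
  move=> s t s0 st x; rewrite opprD addrACA subrr add0r ripBl !zP.
  by rewrite primitiveB//; exact: bochner_rip.
rewrite (_ : z 0 = 0) ?addr0//; apply/(@rnorm_eq0 R H)/eqP.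
by rewrite -sqrf_eq0 -(ripxx hilbertH) zP primitive0.
Qed.

(** Testing the difference of increments against itself turns the weak identity
    into the norm estimate. *)
Lemma weak_primitive_dist f f' U V h s t : bochner_integrable f -> bochner_integrable f' ->
  weak_primitive f U -> weak_primitive f' V ->
  locint h -> (forall r, 0 <= h r) -> 0 <= s -> s <= t ->
  {ae mu, forall r, s < r -> r <= t -> rnorm (f r - f' r) <= h r} ->
  rnorm ((U t - U s) - (V t - V s)) <= \int[mu]_(r in `]s, t]) h r.
Proof.
move=> bf bf' fU f'V lh h0 s0 st fh; set w := _ - _.
have [->|w0] := eqVneq (rnorm w) 0; first exact: Rintegral_ge0.
have {}w0 : 0 < rnorm w by rewrite lt_neqAle eq_sym w0 rnorm_ge0.
rewrite -(ler_pM2r w0) -expr2 -(ripxx hilbertH) {1}/w ripBl fU// f'V//.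
rewrite -RintegralB//; try by apply: locint_itvoc; exact: bochner_rip.
rewrite -RintegralZr//; last exact: locint_itvoc.
apply: ae_le_Rintegral_itv.
- by apply: locally_integrableB; exact: bochner_rip.
- by apply: locintZ => //; exact: rnorm_ge0.
- apply: aeS fh => r fh sr rt; rewrite -ripBl (le_trans (rip_le hilbertH _ _))//.
  by rewrite ler_wpM2r ?rnorm_ge0// fh.
Qed.

Lemma weak_primitive_cst y : weak_primitive (cst y) (fun t => t *r y).
Proof.
move=> s t s0 st x.
by rewrite [RHS](Rintegral_itv_cst (rip y x) st) -rscaleBl ripZl mulrC.
Qed.

(** Comparison with a constant integrand, the source of absolute continuity
    (y = 0) and of differentiability (y close to f t). *)
Lemma weak_primitive_linear f U y h s t : bochner_integrable f -> weak_primitive f U ->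
  locint h -> (forall r, 0 <= h r) -> 0 <= s -> s <= t ->
  {ae mu, forall r, s < r -> r <= t -> rnorm (f r - y) <= h r} ->
  rnorm (U t - U s - (t - s) *r y) <= \int[mu]_(r in `]s, t]) h r.
Proof.
move=> bf fU lh h0 s0 st fh; rewrite rscaleBl.
exact: (weak_primitive_dist bf (bochner_cst y) fU (weak_primitive_cst y)).
Qed.

Lemma weak_primitive_bound f U h s t : bochner_integrable f -> weak_primitive f U ->
  locint h -> (forall r, rnorm (f r) <= h r) -> 0 <= s -> s <= t ->
  rnorm (U t - U s) <= primitive h t - primitive h s.
Proof.
move=> bf fU lh fh s0 st; rewrite primitiveB//.
have := weak_primitive_linear (y := 0) bf fU lh _ s0 st.
rewrite scaler0 subr0; apply => [r|]; first exact: le_trans (rnorm_ge0 _) (fh r).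
by apply: aeW => r _ _; rewrite subr0.
Qed.

(** Differentiability at t tested on all small intervals around t: this is the
    form in which estimates of integrals over ]s, s'] apply. *)
Definition straddle_derivative U t y : Prop := forall e : R, 0 < e ->
  exists2 d : R, 0 < d & forall s s',
    0 <= s -> t - d < s -> s <= t -> t <= s' -> s' < t + d ->
    rnorm (U s' - U s - (s' - s) *r y) <= e * (s' - s).

Lemma has_derivativeP U t y : 0 <= t ->
  has_derivative U t y <-> straddle_derivative U t y.
Proof.
move=> t0.
have quotient (h : R) : h != 0 -> h^-1 *r (U (t + h) - U t) - y =
    h^-1 *r (U (t + h) - U t - h *r y).
  by move=> h0; rewrite [in RHS]scalerBr rscaleA mulVf// rscale1.
split=> [/rcvgP dU e e0|dU].
  have := dU _ e0; rewrite near_withinE => /nbhs_ballP[d /= d0 hd].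
  have pt r : 0 <= r -> t - d < r -> r < t + d ->
      rnorm (U r - U t - (r - t) *r y) <= e * `|r - t|.
    move=> r0 tr rt; have [->|rt0] := eqVneq r t.
      by rewrite !subrr rmorph0 scale0r subr0 rnorm0 normr0 mulr0.
    have rt0' : r - t != 0 by rewrite subr_eq0.
    have /hd : ball 0 d (r - t).
      by rewrite /ball /= sub0r normrN ltr_norml; lra.
    move=> /(_ rt0'); rewrite /= quotient// (addrC t) subrK => /(_ r0).
    by rewrite rnormZ normfV ltr_pdivrMl ?normr_gt0// => /ltW; rewrite mulrC.
  exists d => // s s' s0 ds st ts' s'd.
  rewrite (_ : _ - _ = (U s' - U t - (s' - t) *r y) - (U s - U t - (s - t) *r y)).
    apply: le_trans (rnormB _ _) _.
    apply: le_trans (lerD (pt s' _ _ _) (pt s _ _ _)) _; try lra.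
    by rewrite ger0_norm ?subr_ge0// ler0_norm ?subr_le0//; lra.
  rewrite [in RHS]opprD [in RHS]addrACA -opprD -rscaleBl opprB addrA subrK.
  by congr (_ - _ *r _); ring.
apply/rcvgP => e e0; have [d d0 hd] := dU _ (divr_gt0 e0 (ltr0n R 2)).
rewrite near_withinE; apply/nbhs_ballP; exists d => // h /=.
rewrite /ball /= sub0r normrN => hd' h0 th.
have hn : 0 < `|h| by rewrite normr_gt0.
rewrite quotient// rnormZ normfV ltr_pdivrMl//.
apply: (@le_lt_trans _ _ (e / 2 * `|h|)); last first.
  by rewrite mulrC ltr_pM2l// ltr_pdivrMr// ltr_pMr// ltr1n.
move: hd'; rewrite ltr_norml => /andP[h1 h2].
have [hpos|hneg] := leP 0 h.
  have := hd t (t + h) t0; rewrite (addrC t h) addrK ger0_norm//.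
  by apply; lra.
have thB : t - (t + h) = - h by ring.
have := hd (t + h) t th; rewrite thB ltr0_norm// rscaleNl opprK.
rewrite -[in rnorm (_ - _ - _)]rnormN !opprB [_ *r _ + _]addrC.
by apply; lra.
Qed.

(** Compare f with a value y_k close to f t: the averages of |f - y_k| around a
    Lebesgue point tend to |f t - y_k|, which is small. *)
Lemma ae_straddle_derivative f U : bochner_integrable f -> weak_primitive f U ->
  {ae mu, forall t, 0 <= t -> straddle_derivative U t (f t)}.
Proof.
move=> bf fU; have [[y yf] _] := bf.1.
have := ae_foralln (fun k => lebesgue_differentiation (bochner_dist (y k) bf)).
apply: aeS => t lt t0 e e0.
have e4 : 0 < e / 4 by rewrite divr_gt0.
have [k yk] := yf t _ e4.
have [d d0 hd] := lebesgue_pt_average (bochner_dist (y k) bf) (lt k) e4.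
exists d => // s s' s0 ds st ts' s'd.
have ss' : s <= s' by exact: le_trans ts'.
apply: le_trans (rdist_triangle ((s' - s) *r y k) _ _) _.
have -> : (s' - s) *r y k - (s' - s) *r f t = (s' - s) *r (y k - f t).
  by rewrite scalerBr.
rewrite rnormZ ger0_norm ?subr_ge0//.
have h1 : rnorm (U s' - U s - (s' - s) *r y k) <= (rnorm (f t - y k) + e / 4) * (s' - s).
  apply: le_trans (hd s s' ds st ts' s'd).
  apply: (weak_primitive_linear bf fU (bochner_dist (y k) bf)) => //.
  - by move=> r; exact: rnorm_ge0.
  - by apply: aeW => r _ _.
apply: le_trans (lerD h1 (lexx _)) _.
rewrite mulrC -mulrDr [leRHS]mulrC ler_wpM2l ?subr_ge0// (rdistC (y k)).
lra.
Qed.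

Lemma straddle_derivative_near f U t y : bochner_integrable f -> weak_primitive f U ->
  (forall e : R, 0 < e -> exists2 d : R, 0 < d &
    {ae mu, forall r, 0 <= r -> `|r - t| < d -> rnorm (f r - y) <= e}) ->
  straddle_derivative U t y.
Proof.
move=> bf fU fy e e0; have [d d0 hd] := fy e e0.
exists d => // s s' s0 ds st ts' s'd.
have ss' : s <= s' by exact: le_trans ts'.
rewrite -(Rintegral_itv_cst e ss').
apply: (weak_primitive_linear bf fU (locint_cst e)) => //.
  by move=> r /=; exact: ltW.
apply: aeS hd => r hr sr rs'; apply: hr; first by rewrite ltW// (le_lt_trans s0).
rewrite ltr_norml; apply/andP; split; lra.
Qed.

End WeakIntegral.

(** * Derivatives and elementary estimates on the line *)

Section RealDerivative.
Variable R : realType.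
Implicit Types (f : R -> R) (t l e : R).

Lemma is_derive_increment f t l e : is_derive t 1 f l -> 0 < e ->
  exists2 d : R, 0 < d & forall s, `|s - t| < d ->
    `|f s - f t - (s - t) * l| <= e * `|s - t|.
Proof.
move=> [/[dup] df /cvg_ex[l' /= l'P] fl] e0.
have fl' : l' = l by rewrite -fl; apply/esym/cvg_lim.
rewrite {}fl' in l'P.
move/cvgrPdist_lt : l'P => /(_ _ e0); rewrite near_withinE.
move=> /nbhs_ballP[d /= d0 hd]; exists d => // s std.
have [->|st] := eqVneq s t; first by rewrite !subrr mul0r subrr normr0 mulr0.
have st0 : s - t != 0 by rewrite subr_eq0.
have := hd (s - t); rewrite /ball /= sub0r normrN => /(_ std st0).
rewrite [_%:A]mulr1 subrK -[_ *: _]/(_ * _) => h.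
rewrite -(@ler_pM2l _ `|s - t|^-1) ?invr_gt0 ?normr_gt0//.
rewrite [leRHS]mulrCA mulVf ?normr_eq0// mulr1 -normfV -normrM.
by rewrite mulrBr mulrA mulVf// mul1r distrC ltW.
Qed.

Lemma is_derive_le0_straddle f t l e : is_derive t 1 f l -> l <= 0 -> 0 < e ->
  exists2 d : R, 0 < d & forall s s', t - d < s -> s <= t -> t <= s' -> s' < t + d ->
    f s' - f s <= e * (s' - s).
Proof.
move=> dfl l0 e0; have [d d0 hd] := is_derive_increment dfl e0.
exists d => // s s' ds st ts' s'd.
have /hd : `|s' - t| < d by rewrite ger0_norm ?subr_ge0//; lra.
have /hd : `|s - t| < d by rewrite ler0_norm ?subr_le0//; lra.
rewrite (@ger0_norm _ (s' - t)) ?subr_ge0// (@ler0_norm _ (s - t)) ?subr_le0//.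
rewrite !ler_norml => /andP[h1 h2] /andP[h3 h4].
have : (s' - s) * l <= 0 by rewrite mulr_ge0_le0// subr_ge0 (le_trans st).
lra.
Qed.

Lemma increment_is_derive f t l :
  (forall e, 0 < e -> exists2 d : R, 0 < d & forall s, `|s - t| < d ->
    `|f s - f t - (s - t) * l| <= e * `|s - t|) -> is_derive t 1 f l.
Proof.
move=> h.
have hl : (fun h : R => h^-1 *: (f (h *: (1 : R) + t) - f t)) @ 0^' --> l.
  apply/cvgrPdist_lt => e e0; rewrite near_withinE.
  have [d d0 hd] := h _ (divr_gt0 e0 (ltr0n R 2)).
  apply/nbhs_ballP; exists d => // r /=; rewrite /ball /= sub0r normrN => rd r0.
  have := hd (r + t); rewrite addrK => /(_ rd).
  rewrite [_%:A]mulr1 -[_ *: _]/(_ * _) => hr.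
  have rn : 0 < `|r| by rewrite normr_gt0.
  rewrite -(@ltr_pM2l _ `|r|)// -normrM mulrBr mulrA divff// mul1r distrC.
  apply: le_lt_trans hr _.
  by rewrite mulrC ltr_pM2l// ltr_pdivrMr// ltr_pMr// ltr1n.
apply: DeriveDef; first by apply/cvg_ex; exists l.
exact/cvg_lim.
Qed.

(** Convexity of the exponential. *)
Lemma expR_increment (a b : R) : b <= a -> `|expR a - expR b| <= expR a * (a - b).
Proof.
move=> ba; rewrite ger0_norm ?subr_ge0 ?ler_expR//.
have := expR_ge1Dx (b - a); rewrite expRD => h.
have := ler_wpM2l (expR_ge0 a) h; rewrite mulrCA -expRD subrr expR0; lra.
Qed.

Lemma half_pow_small (B e : R) : 0 < e -> exists n, B * 2^-1 ^+ n < e.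
Proof.
move=> e0; have B0 : 0 < `|B| + 1 by rewrite ltr_pwDr.
have h2 : `|2^-1 : R| < 1 by rewrite ger0_norm ?invr_ge0// invf_lt1// ltr1n.
have [n _ /(_ n (leqnn _)) /=] :=
  @cvgr0_norm_lt _ _ _ _ _ _ (cvg_expr h2) _ (divr_gt0 e0 B0).
rewrite ger0_norm ?exprn_ge0 ?invr_ge0// ltr_pdivlMr// => h.
exists n; apply: le_lt_trans h; rewrite mulrC ler_wpM2l ?exprn_ge0 ?invr_ge0//.
by rewrite (le_trans (ler_norm _))// lerDl.
Qed.

End RealDerivative.

(** * The exponential weight *)

Section Weight.
Variable R : realType.
Local Notation mu := (@lebesgue_measure R).
Local Notation locint := (@locally_integrable R setT).
Variable m : R -> R.
Hypotheses (lm : locint m) (m0 : forall t, 0 <= m t).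
Implicit Types s t : R.

Definition weight t := expR (2 * primitive m t).

Lemma weight_ge1 t : 1 <= weight t.
Proof. by rewrite -expR0 ler_expR mulr_ge0// primitive_ge0. Qed.

Lemma weight_ge0 t : 0 <= weight t.
Proof. exact: expR_ge0. Qed.

Lemma weight_homo : {homo weight : s t / s <= t}.
Proof. by move=> s t st; rewrite ler_expR ler_wpM2l// primitive_homo. Qed.

Lemma locint_mweight : locint (fun t => m t * weight t).
Proof. by apply: locint_weight => //; [exact: weight_ge0|exact: weight_homo]. Qed.

Lemma mweight_ge0 t : 0 <= m t * weight t.
Proof. by rewrite mulr_ge0// weight_ge0. Qed.

(** The weight is a primitive of 2 m weight, up to the constant 1. *)
Lemma primitive_mweight t : 0 <= t ->
  primitive (fun s => m s * weight s) t <= weight t / 2.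
Proof.
move=> t0.
pose F s := 2 * primitive (fun s => m s * weight s) s - weight s.
suff : F t <= F 0.
  rewrite /F primitive0 mulr0 sub0r => h; have := weight_ge0 0; lra.
apply: real_ac_le => //.
  refine (@small_increments_dom _ t (2 + 2 * weight t) _ _ _ _
    (small_increments_primitive t lm m0)
    (small_increments_primitive t locint_mweight mweight_ge0) _).
    by rewrite addr_ge0// mulr_ge0// weight_ge0.
  move=> s s' s0 ss' s't.
  have p1 := primitive_homo locint_mweight mweight_ge0 ss'.
  have p2 := primitive_homo lm m0 ss'.
  rewrite /F.
  have -> : 2 * primitive (fun s => m s * weight s) s' - weight s' -
     (2 * primitive (fun s => m s * weight s) s - weight s) =
     2 * (primitive (fun s => m s * weight s) s' - primitive (fun s => m s * weight s) s)
     - (weight s' - weight s) by ring.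
  apply: le_trans (ler_normB _ _) _.
  have : `|weight s' - weight s| <= weight t * (2 * (primitive m s' - primitive m s)).
    apply: le_trans (expR_increment _) _; first by rewrite ler_wpM2l.
    rewrite -mulrBr ler_wpM2r//; last exact: weight_homo.
    by rewrite mulr_ge0// subr_ge0.
  rewrite (@ger0_norm _ (2 * _)); last by rewrite mulr_ge0// subr_ge0.
  have := weight_ge0 t.
  move: p1 p2; rewrite -subr_ge0 -[in X in _ -> X -> _]subr_ge0.
  set a := _ - _; set b := _ - _; set w := weight t => a0 b0 w0 h.
  have : 0 <= w * a by exact: mulr_ge0.
  lra.
apply: aeS2 (ae_is_derive_primitive lm) (ae_is_derive_primitive locint_mweight).
move=> s ds1 ds2 s0 st e e0.
have d1 := ds1 s0; have d3 := ds2 s0.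
have dF : is_derive s 1 F 0.
  have dw : is_derive s 1 weight (2 * m s * weight s).
    have d2m : is_derive s 1 (2 \*: primitive m) (2 *: m s) by exact: is_deriveZ.
    have := @is_derive1_comp _ expR (2 \*: primitive m) _ _ _ (is_derive_expR _) d2m.
    by rewrite mulrC.
  have d2 : is_derive s 1 (2 \*: primitive (fun s => m s * weight s)) (2 *: (m s * weight s)).
    exact: is_deriveZ.
  have := is_deriveB d2 dw.
  by rewrite -[_ *: _]/(_ * _) mulrA subrr.
have [d d0 hd] := is_derive_le0_straddle dF (lexx _) e0.
by exists d => // r r' _ h1 h2 h3 h4 _; exact: hd.
Qed.

End Weight.

(** * Existence by Picard iteration *)

Section Existence.
Variables (R : realType) (H : completeNormedModType R[i]).
Variable (ip : {dot H for Num.conj}).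
Hypothesis hilbertH : is_hilbert ip.
Local Notation mu := (@lebesgue_measure R).
Local Notation locint := (@locally_integrable R setT).
Variables (M : R -> H -> H) (m : R -> R).
Hypotheses (lm : locint m) (m0 : forall t, 0 <= m t).
Hypothesis M_pettis : forall x, ae_pettis_measurable (fun t => M t x).
Hypothesis M_lip : forall t x y, 0 <= t ->
  rnorm (M t x - M t y) <= m t * rnorm (x - y).
Hypothesis M_0 : forall t, 0 <= t -> M t 0 = 0.
Variable u0 : H.
Local Notation w := (weight m).
Implicit Types (u v U V f : R -> H) (s t : R).

Lemma operator_growth t x : 0 <= t -> rnorm (M t x) <= m t * rnorm x.
Proof. by move=> t0; have := M_lip x 0 t0; rewrite M_0// !subr0. Qed.

Let K := 2 * rnorm u0.

Let K0 : 0 <= K. Proof. by rewrite mulr_ge0// rnorm_ge0. Qed.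

(** The iteration stays among continuous curves of growth K times the weight:
    the Picard map gives |u0| + K / 2 w, which K = 2 |u0| keeps below K w. *)
Let admissible u := nonneg_continuous u /\ forall t, 0 <= t -> rnorm (u t) <= K * w t.

(** U = u0 + int M u, with a measurable representative f of M u that obeys the
    growth bound everywhere. *)
Definition integrates u U := exists f, [/\ bochner_integrable f,
  forall t, rnorm (f t) <= K * (m t * w t),
  {ae mu, forall t, 0 <= t -> f t = M t (u t)},
  weak_primitive ip f U & U 0 = u0].

Let locint_K (c : R) : 0 <= c -> locint (fun t => c * (m t * w t)).
Proof. by apply: locintZl; [exact: locint_mweight|exact: mweight_ge0]. Qed.

Let primitive_K (c : R) t : 0 <= c -> 0 <= t ->
  primitive (fun t => c * (m t * w t)) t <= c / 2 * w t.
Proof.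
move=> c0 t0; rewrite /primitive RintegralZl//; last first.
  by apply: locint_itvoc; exact: locint_mweight.
by rewrite mulrAC -mulrA ler_wpM2l//; exact: primitive_mweight.
Qed.

Lemma weak_primitive_continuous f U h : bochner_integrable f -> weak_primitive ip f U ->
  locint h -> (forall r, rnorm (f r) <= h r) -> nonneg_continuous U.
Proof.
move=> bf fU lh fh t t0 e e0.
have h0 r : 0 <= h r by exact: le_trans (rnorm_ge0 _) (fh r).
have [d d0 hd] := small_increments_pt (small_increments_primitive (t + 1) lh h0) e0.
exists (Num.min 1 d); first by rewrite lt_min ltr01.
move=> s s0; rewrite lt_min => /andP[s1 sd].
have b r r' := weak_primitive_bound hilbertH (s := r) (t := r') bf fU lh fh.
have [st|ts] := leP s t.
  rewrite rdistC; apply: le_lt_trans (b _ _ s0 st) _; apply: hd => //.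
    by rewrite lerDl.
  by move: sd; rewrite distrC ger0_norm ?subr_ge0.
apply: le_lt_trans (b _ _ t0 (ltW ts)) _; apply: hd => //; first exact: ltW.
  by move: s1; rewrite gtr0_norm ?subr_gt0// => /ltW; rewrite lerBlDl.
by move: sd; rewrite gtr0_norm ?subr_gt0.
Qed.

Lemma integrates_exists u : admissible u -> exists2 U, admissible U & integrates u U.
Proof.
move=> [cu bu].
have [f [pf fM fneg aef]] := ae_pettis_curve M_pettis M_lip cu.
have fK t : rnorm (f t) <= K * (m t * w t).
  have mw0 : 0 <= K * (m t * w t) by rewrite mulr_ge0// mweight_ge0.
  have [t0|t0] := leP 0 t; last by rewrite fneg// rnorm0.
  case: (fM t) => ->; last by rewrite rnorm0.
  by rewrite (le_trans (operator_growth _ t0))// mulrCA ler_wpM2l// bu.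
have lK := locint_K K0.
have bf := bochner_le pf fK lK.
have [U fU U0] := weak_primitive_exists hilbertH u0 bf.
exists U; last by exists f.
split; first exact: weak_primitive_continuous fK.
move=> t t0; have := weak_primitive_bound hilbertH bf fU lK fK (lexx 0) t0.
rewrite primitive0 subr0 U0 => h.
have := le_trans h (primitive_K K0 t0).
have := rnormD (U t - u0) u0; rewrite subrK.
have : rnorm u0 <= K / 2 * w t.
  have -> : K / 2 = rnorm u0 by rewrite /K; field.
  by rewrite ler_peMr ?rnorm_ge0// weight_ge1.
lra.
Qed.

(** The weight makes the Picard map a contraction of ratio 1 / 2 on the whole
    half-line. *)
Lemma integrates_contract u v U V (c : R) : 0 <= c ->
  integrates u U -> integrates v V ->
  (forall t, 0 <= t -> rnorm (u t - v t) <= c * w t) ->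
  forall t, 0 <= t -> rnorm (U t - V t) <= c / 2 * w t.
Proof.
move=> c0 [f [bf _ aef fU U0]] [g [bg _ aeg gV V0]] uv t t0.
have lc := locint_K c0.
apply: le_trans (primitive_K c0 t0).
rewrite -[leRHS]subr0 -(primitive0 (fun t => c * (m t * w t))) primitiveB//.
have -> : U t - V t = (U t - U 0) - (V t - V 0).
  by rewrite U0 V0 opprB addrA subrK.
apply: (weak_primitive_dist hilbertH bf bg fU gV lc _ (lexx 0) t0).
  by move=> r; rewrite mulr_ge0// mweight_ge0.
apply: aeS2 aef aeg => r fr gr r0 _; rewrite (fr (ltW r0)) (gr (ltW r0)).
rewrite (le_trans (M_lip _ _ (ltW r0)))// mulrCA ler_wpM2l//.
exact/uv/ltW.
Qed.

(** The iterates converge at every t, locally uniformly, with error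
    4 K w 2^-n; by the contraction estimate they also converge to the
    Picard image of their limit, which is therefore a fixed point. *)
Lemma solution_exists : exists2 u, nonneg_continuous u & integrates u u.
Proof.
have /choice[S SP] : forall u, exists U, admissible u -> admissible U /\ integrates u U.
  move=> u; have [au|nau] := pselect (admissible u); last by exists u.
  by have [U aU iU] := integrates_exists au; exists U.
pose a n := iter n S (fun=> u0).
have a0 : admissible (a 0%N).
  split=> [t t0 e e0|t t0]; first by exists 1 => // s _ _; rewrite subrr rnorm0.
  rewrite /a /= /K; have := weight_ge1 m0 t; have := rnorm_ge0 u0; nra.
have aP n : admissible (a n) by elim: n => // n /SP[].
have aS n : integrates (a n) (a n.+1) by have [] := SP _ (aP n).
have incr n t : 0 <= t -> rnorm (a n.+1 t - a n t) <= 2 * K * 2^-1 ^+ n * w t.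
  elim: n t => [|n IHn] t t0.
    rewrite expr0 mulr1; apply: le_trans (rnormB _ _) _.
    have := (aP 1%N).2 t t0; have := (aP 0%N).2 t t0; lra.
  have c0 : 0 <= 2 * K * 2^-1 ^+ n by apply: mulr_ge0; [exact: mulr_ge0|exact: exprn_ge0].
  have -> : 2 * K * 2^-1 ^+ n.+1 = 2 * K * 2^-1 ^+ n / 2 by rewrite exprSr mulrA.
  exact: integrates_contract c0 (aS n.+1) (aS n) IHn t t0.
pose c t n : R := 4 * K * w t * 2^-1 ^+ n.
have Kw t : 0 <= 4 * K * w t.
  by apply: mulr_ge0; [exact: mulr_ge0|exact: weight_ge0].
have c_ge0 t n : 0 <= c t n by apply: mulr_ge0 => //; exact: exprn_ge0.
have cS t n : c t n.+1 = c t n / 2 by rewrite /c exprSr mulrA.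
have dist t i j : 0 <= t -> (i <= j)%N -> rnorm (a j t - a i t) <= c t i.
  move=> t0 ij; suff : rnorm (a j t - a i t) <= c t i - c t j.
    by have := c_ge0 t j; lra.
  elim: j ij => [|j IHj]; first by rewrite leqn0 => /eqP ->; rewrite !subrr rnorm0.
  rewrite leq_eqVlt => /predU1P[->|]; first by rewrite !subrr rnorm0.
  rewrite ltnS => /IHj h; apply: le_trans (rdist_triangle (a j t) _ _) _.
  have := incr j t t0; rewrite cS.
  have -> : 2 * K * 2^-1 ^+ j * w t = c t j / 2 by rewrite /c; field.
  lra.
have c0 t : c t n @[n --> \oo] --> 0.
  rewrite -(mulr0 (4 * K * w t)); apply: cvgMr.
  by apply: cvg_expr; rewrite ger0_norm ?invr_ge0// invf_lt1// ltr1n.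
have /choice[u uP] : forall t, exists l, 0 <= t -> forall i, rnorm (l - a i t) <= c t i.
  move=> t; have [t0|t0] := leP 0 t; last by exists 0.
  by have [l _ hl] := rcauchy_cvg (c0 t) (fun i j => @dist t i j t0); exists l.
have au : admissible u.
  split=> [t t0 e e0|t t0]; last first.
    apply/ler_addgt0Pr => e e0; have [n ne] := half_pow_small (4 * K * w t) e0.
    have := uP t t0 n; have := (aP n).2 t t0.
    have := rnormD (u t - a n t) (a n t); rewrite subrK /c; lra.
  have t1 : 0 <= t + 1 by rewrite addr_ge0.
  have e3 : 0 < e / 3 by rewrite divr_gt0.
  have [n ne] := half_pow_small (4 * K * w (t + 1)) e3.
  have cn r : 0 <= r -> r <= t + 1 -> rnorm (u r - a n r) < e / 3.
    move=> r0 rt; apply: le_lt_trans (uP r r0 n) _; apply: le_lt_trans ne.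
    rewrite /c; apply: ler_wpM2r; first exact: exprn_ge0.
    by apply: ler_wpM2l; [exact: mulr_ge0|exact: (weight_homo lm m0)].
  have [d d0 hd] := (aP n).1 t t0 _ e3.
  exists (Num.min 1 d); first by rewrite lt_min ltr01.
  move=> s s0; rewrite lt_min => /andP[s1 sd].
  have s1' : s <= t + 1 by move: s1; rewrite ltr_norml; lra.
  have h1 := cn s s0 s1'; have h2 := cn t t0 (ltac:(by rewrite lerDl)).
  have h3 := hd s s0 sd.
  have := rdist_triangle (a n s) (u s) (u t).
  have := rdist_triangle (a n t) (a n s) (u t).
  rewrite (rdistC (a n t)); lra.
have [aU] := SP _ au; set U := S u => iU.
have Uu t : 0 <= t -> U t = u t.
  move=> t0; apply/eqP; rewrite -subr_eq0; apply/eqP/(@rnorm_eq0 R H)/eqP.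
  rewrite eq_le rnorm_ge0 andbT; apply/ler_addgt0Pr => e e0; rewrite add0r.
  have [n ne] := half_pow_small (4 * K * w t) e0.
  have cn0 : 0 <= 4 * K * 2^-1 ^+ n by apply: mulr_ge0; [exact: mulr_ge0|exact: exprn_ge0].
  have un r : 0 <= r -> rnorm (u r - a n r) <= 4 * K * 2^-1 ^+ n * w r.
    by move=> r0; rewrite mulrAC; exact: uP.
  have := integrates_contract cn0 iU (aS n) un t0.
  have -> : 4 * K * 2^-1 ^+ n / 2 * w t = c t n / 2 by rewrite /c; field.
  have := uP t t0 n.+1; rewrite cS (rdistC (u t)).
  have := rdist_triangle (a n.+1 t) (U t) (u t).
  have {ne} : c t n < e := ne.
  lra.
exists u; first by case: au.
have [f [bf fK aef fU U0]] := iU.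
exists f; split => //; last by rewrite -Uu.
by move=> s t s0 st x; rewrite -!Uu ?fU//; exact: le_trans st.
Qed.

End Existence.

(** * The energy inequality *)

Section Energy.
Variables (R : realType) (H : completeNormedModType R[i]).
Variable (ip : {dot H for Num.conj}).
Hypothesis hilbertH : is_hilbert ip.
Local Notation rip := (rip ip).
Local Notation mu := (@lebesgue_measure R).
Local Notation locint := (@locally_integrable R setT).
Implicit Types (u v l : R -> H) (s t T : R).

Definition curve_ac T v := small_increments T (fun s t => rnorm (v t - v s)).

Lemma curve_acP T v : absolutely_continuous 0 T v <-> curve_ac T v.
Proof.
split=> vT e e0; have [d d0 hd] := vT e e0; exists d => // n x y.
  by move=> [xy1 xy2]; exact: hd.
by move=> xy1 xy2; apply: hd; split.
Qed.

Lemma curve_acB T u v : curve_ac T u -> curve_ac T v -> curve_ac T (fun t => u t - v t).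
Proof.
move=> uT vT; apply: (small_increments_dom ler01 uT vT) => s t s0 st tT.
by rewrite mul1r subr_interchange rnormB.
Qed.

(** Cross [0, T] in steps of length d / 2, each changing the curve by less than
    1. *)
Lemma curve_ac_bounded T v : curve_ac T v ->
  exists2 B, 0 <= B & forall t, 0 <= t -> t <= T -> rnorm (v t) <= B.
Proof.
move=> vT; have [d d0 hd] := small_increments_pt vT ltr01.
have d20 : 0 < d / 2 by rewrite divr_gt0.
have steps (n : nat) t : 0 <= t -> t <= T -> t <= n%:R * (d / 2) ->
    rnorm (v t) <= rnorm (v 0) + n%:R.
  elim: n t => [|n IHn] t t0 tT.
    by rewrite mul0r addr0 => t0'; have -> : t = 0 by apply/eqP; rewrite eq_le t0 t0'.
  rewrite -natr1 mulrDl mul1r => tn.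
  pose t' := Num.max 0 (t - d / 2).
  have t't : t' <= t by rewrite ge_max t0 gerBl ltW.
  have t'0 : 0 <= t' by rewrite le_max lexx.
  have td : t - t' < d.
    have : t - d / 2 <= t' by rewrite le_max lexx orbT.
    lra.
  have t'n : t' <= n%:R * (d / 2).
    rewrite ge_max; apply/andP; split; last by lra.
    by rewrite mulr_ge0// ltW.
  have := IHn _ t'0 (le_trans t't tT) t'n.
  have := hd _ _ t'0 t't tT td; have := rnormD (v t - v t') (v t'); rewrite subrK.
  lra.
pose n := (Num.trunc (T / (d / 2))).+1.
exists (rnorm (v 0) + n%:R); first by rewrite addr_ge0// rnorm_ge0.
move=> t t0 tT; apply: steps => //; apply: le_trans tT _.
by rewrite -ler_pdivrMr// ltW// -truncn_le_nat.
Qed.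

(** |v s|^2 - |v t|^2 = 2 Re (v s - v t, v t) + |v s - v t|^2, where the last
    term is of second order. *)
Lemma is_derive_rnorm_sqr v t y : 0 < t -> straddle_derivative v t y ->
  is_derive t 1 (fun s => rnorm (v s) ^+ 2) (2 * rip y (v t)).
Proof.
move=> t0 dv; apply: increment_is_derive => e e0.
pose A := 2 * rnorm (v t) + (rnorm y + 1) ^+ 2.
have A0 : 0 <= A.
  by apply: addr_ge0; [rewrite mulr_ge0 ?rnorm_ge0|exact: sqr_ge0].
have A1 : 0 < A + 1 by rewrite ltr_wpDl.
pose e' := Num.min 1 (e / (A + 1)).
have e'0 : 0 < e' by rewrite lt_min ltr01 divr_gt0.
have [d d0 hd] := dv e' e'0.
exists (Num.min t (Num.min d e')); first by rewrite lt_min t0 lt_min d0.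
move=> s; rewrite lt_min lt_min => /and3P[st sd se].
have s0 : 0 <= s by move: st; rewrite ltr_norml; lra.
have hs : rnorm (v s - v t - (s - t) *r y) <= e' * `|s - t|.
  move: sd; rewrite ltr_norml => /andP[sd1 sd2].
  have [ts|ts] := leP t s.
    by rewrite ger0_norm ?subr_ge0//; apply: hd; lra.
  have := hd s t s0; rewrite ltr0_norm ?subr_lt0// opprB => h.
  rewrite -rnormN [X in rnorm X](_ : _ = v t - v s - (t - s) *r y); last first.
    by rewrite opprB (opprB (v s)) addrC -rscaleNl opprB.
  by apply: h; lra.
set r := v s - v t - _ in hs.
have vs : v s - v t = (s - t) *r y + r by rewrite /r [RHS]addrC subrK.
have nvs : rnorm (v s - v t) <= (rnorm y + 1) * `|s - t|.
  rewrite vs (le_trans (rnormD _ _))// rnormZ.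
  have : e' * `|s - t| <= 1 * `|s - t| by rewrite ler_wpM2r// ge_min lexx.
  lra.
have -> : rnorm (v s) ^+ 2 - rnorm (v t) ^+ 2 - (s - t) * (2 * rip y (v t)) =
    2 * rip r (v t) + rnorm (v s - v t) ^+ 2.
  have -> : v s = v t + (v s - v t) by rewrite addrC subrK.
  rewrite (rnormD_sqr hilbertH) (addrC (v t)) addrK ripC {1}vs ripDl ripZl; ring.
apply: le_trans (ler_normD _ _) _.
have h1 : `|2 * rip r (v t)| <= 2 * rnorm (v t) * (e' * `|s - t|).
  rewrite normrM ger0_norm// -mulrA ler_wpM2l//.
  by rewrite (le_trans (normr_rip_le hilbertH _ _))// mulrC ler_wpM2l ?rnorm_ge0.
have h2 : `|rnorm (v s - v t) ^+ 2| <= (rnorm y + 1) ^+ 2 * (e' * `|s - t|).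
  rewrite ger0_norm ?sqr_ge0//.
  apply: (@le_trans _ _ (((rnorm y + 1) * `|s - t|) ^+ 2)).
    by rewrite lerXn2r// nnegrE ?mulr_ge0 ?addr_ge0 ?rnorm_ge0.
  rewrite exprMn ler_wpM2l ?sqr_ge0// expr2 ler_wpM2r// ltW//.
apply: le_trans (lerD h1 h2) _.
rewrite -mulrDl mulrA ler_wpM2r//.
apply: (@le_trans _ _ (A * (e / (A + 1)))).
  by rewrite ler_wpM2l// ge_min lexx orbT.
by rewrite mulrA ler_pdivrMr// mulrC ler_wpM2l ?ltW// ltrDl.
Qed.

Variables (b : R -> R).
Hypotheses (lb : locint b) (b0 : forall t, 0 <= b t).

(** Gronwall for the energy: exp (- 2 int b) |v|^2 is absolutely continuous with
    nonpositive derivative almost everywhere. *)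
Lemma energy_bound v l : (forall T, 0 <= T -> curve_ac T v) ->
  {ae mu, forall t, 0 <= t -> straddle_derivative v t (l t) /\
     rip (l t) (v t) <= b t * rnorm (v t) ^+ 2} ->
  forall t, 0 <= t -> rnorm (v t) <= expR (primitive b t) * rnorm (v 0).
Proof.
move=> acv dv t t0.
pose E s := expR (- 2 * primitive b s).
pose F s := rnorm (v s) ^+ 2 * E s.
have E0 s : 0 <= E s by exact: expR_ge0.
have E1 s : E s <= 1.
  by rewrite -expR0 ler_expR mulNr oppr_le0 mulr_ge0// primitive_ge0.
have [B B0 vB] := curve_ac_bounded (acv t t0).
suff : F t <= F 0.
  rewrite /F /E primitive0 mulr0 expR0 mulr1 => h.
  have : rnorm (v t) ^+ 2 <= (expR (primitive b t) * rnorm (v 0)) ^+ 2.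
    rewrite exprMn -expRM_natl.
    have e2 := expR_gt0 (- 2 * primitive b t).
    rewrite -(ler_pM2r e2) (le_trans h)// mulrAC -expRD.
    rewrite (_ : _ + _ = 0) ?expR0 ?mul1r//.
    by rewrite mulNr subrr.
  by rewrite ler_pXn2r// nnegrE ?mulr_ge0 ?rnorm_ge0// expR_ge0.
apply: real_ac_le => //.
  refine (@small_increments_dom _ t (2 * B + 2 * B ^+ 2) _ _ _ _ (acv t t0)
    (small_increments_primitive t lb b0) _).
    by rewrite addr_ge0// mulr_ge0// sqr_ge0.
  move=> s s' s0 ss' s't.
  have s0' := le_trans s0 ss'.
  have p1 : 0 <= primitive b s' - primitive b s by rewrite subr_ge0 primitive_homo.
  have hE : `|E s' - E s| <= 2 * (primitive b s' - primitive b s).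
    rewrite distrC; apply: le_trans (expR_increment _) _.
      by rewrite ler_wnM2l// -subr_ge0.
    have := ler_wpM2r (mulr_ge0 (ler0n R 2) p1) (E1 s).
    by rewrite mul1r /E mulrBr !mulNr opprK (addrC (- _)) -mulrBr.
  have hv : `|rnorm (v s') ^+ 2 - rnorm (v s) ^+ 2| <= 2 * B * rnorm (v s' - v s).
    rewrite subr_sqr normrM mulrC ler_pM// ?rnorm_sub_le//.
    rewrite ger0_norm ?addr_ge0 ?rnorm_ge0//.
    have := vB _ s0 (le_trans ss' s't); have := vB _ s0' s't; lra.
  have -> : F s' - F s = (rnorm (v s') ^+ 2 - rnorm (v s) ^+ 2) * E s' +
     rnorm (v s) ^+ 2 * (E s' - E s) by rewrite /F; ring.
  apply: le_trans (ler_normD _ _) _; rewrite 2!normrM.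
  have h1 : `|rnorm (v s') ^+ 2 - rnorm (v s) ^+ 2| * `|E s'| <= 2 * B * rnorm (v s' - v s).
    by rewrite (le_trans _ hv)// ler_piMr// ger0_norm.
  have h2 : `|rnorm (v s) ^+ 2| * `|E s' - E s| <=
      B ^+ 2 * (2 * (primitive b s' - primitive b s)).
    apply: ler_pM => //; rewrite ger0_norm ?sqr_ge0// lerXn2r ?nnegrE ?rnorm_ge0//.
    exact: vB (le_trans ss' s't).
  apply: le_trans (lerD h1 h2) _.
  have := mulr_ge0 B0 p1; have := mulr_ge0 (sqr_ge0 B) (rnorm_ge0 (v s' - v s)).
  lra.
apply: aeS2 (ae_is_derive_primitive lb) dv => s db dvs s0 st e e0.
have [dv1 le1] := dvs (ltW s0).
have d1 := is_derive_rnorm_sqr s0 dv1.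
have dE : is_derive s 1 E (E s * (- 2 * b s)).
  have d2 : is_derive s 1 (- 2 \*: primitive b) (- 2 *: b s).
    by apply: is_deriveZ; exact: db.
  exact: (@is_derive1_comp _ expR (- 2 \*: primitive b) _ _ _ (is_derive_expR _) d2).
have dF := is_deriveM d1 dE.
have [|d d0 hd] := is_derive_le0_straddle dF _ e0; last first.
  by exists d => // r r' _ h1 h2 h3 h4 _; exact: hd.
rewrite -![_ *: _]/(_ * _).
have -> : rnorm (v s) ^+ 2 * (E s * (- 2 * b s)) + E s * (2 * rip (l s) (v s)) =
  - (2 * E s * (b s * rnorm (v s) ^+ 2 - rip (l s) (v s))) by ring.
by rewrite oppr_le0 !mulr_ge0// subr_ge0.
Qed.

End Energy.

(** * Uniform boundedness *)

Section UniformBoundedness.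
Variables (R : realType) (H : completeNormedModType R[i]).
Variables (T : nat -> H -> H) (k : nat -> R).
Hypothesis TD : forall n x y, T n (x + y) = T n x + T n y.
Hypothesis TZ : forall n (s : R) x, T n (s *r x) = s *r T n x.
Hypothesis k0 : forall n, 0 <= k n.
Hypothesis Tk : forall n x, rnorm (T n x) <= k n * rnorm x.

Let TB n x y : T n (x - y) = T n x - T n y.
Proof. by rewrite TD -[in LHS](rscale1 y) -rscaleNl TZ rscaleNl rscale1. Qed.

(** Around any point, a large operator is large at distance rho: it cannot be
    small at both ends of a segment on whose half-length it is large. *)
Let hump : (forall K, exists n x, K * rnorm x < rnorm (T n x)) ->
  forall (L : R) z (rho : R), 0 < rho ->
  exists n z', rnorm (z' - z) <= rho /\ L <= rnorm (T n z').
Proof.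
move=> unb L z rho rho0; have [n [x Lx]] := unb (L / rho).
have x0 : 0 < rnorm x.
  rewrite lt_neqAle rnorm_ge0 andbT; apply/eqP => /esym x0.
  have := Tk n x; move: Lx; rewrite x0 !mulr0 => h1 h2.
  by have := lt_le_trans h1 h2; rewrite ltxx.
pose y := (rho / rnorm x) *r x.
have ny : rnorm y = rho.
  by rewrite rnormZ ger0_norm ?divr_ge0 ?ltW// divfK ?gt_eqF.
have Ly : L < rnorm (T n y).
  rewrite TZ rnormZ ger0_norm ?divr_ge0 ?ltW// mulrAC ltr_pdivlMr//.
  by move: Lx; rewrite mulrAC ltr_pdivrMr// (mulrC rho).
have [h|h] := leP L (rnorm (T n (z + y))).
  by exists n, (z + y); rewrite addrC addKr ny.
exists n, (z - y); rewrite addrAC subrr add0r rnormN ny; split => //.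
rewrite leNgt; apply/negP => h'.
have : rnorm (2 *r T n y) <= rnorm (T n (z + y)) + rnorm (T n (z - y)).
  apply: le_trans (rnormB _ _); rewrite -TB opprD opprK addrACA subrr add0r.
  by rewrite (_ : y + y = 2 *r y) ?TZ// -[in LHS](rscale1 y) -rscaleDl.
rewrite rnormZ ger0_norm//; lra.
Qed.

(** Gliding hump: otherwise vectors z_j are built with |T_(n_j) z_(j+1)| >= j + 1
    and steps rho_j so small, compared with the bounds k of the operators already
    used, that their limit l keeps |T_(n_j) l| >= j. *)
Lemma uniform_boundedness : (forall x, exists C, forall n, rnorm (T n x) <= C) ->
  exists K, forall n x, rnorm (T n x) <= K * rnorm x.
Proof.
move=> ptw; apply: contrapT => nK.
have unb K : exists n x, K * rnorm x < rnorm (T n x).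
  apply: contrapT => h; apply: nK; exists K => n x; rewrite leNgt; apply/negP => h'.
  by apply: h; exists n, x.
have /choice[g gP] : forall s : R * H * R, exists p : nat * H, 0 < s.2 ->
    rnorm (p.2 - s.1.2) <= s.2 /\ s.1.1 <= rnorm (T p.1 p.2).
  move=> [[L z] rho] /=; have [rho0|_] := ltP 0 rho; last by exists (0%N, 0).
  by have [n [z' h]] := hump unb L z rho0; exists (n, z').
pose S j (s : H * R) : H * R := let p := g (j.+1%:R, s.1, s.2) in
  (p.2, s.2 / (2 * (1 + k p.1))).
pose s := fix s j := if j is j'.+1 then S j' (s j') else (0, 1).
pose z j := (s j).1; pose rho j := (s j).2.
pose n j := (g (j.+1%:R, z j, rho j)).1.
have k1 i : 0 < 1 + k i by rewrite ltr_pwDl.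
have rhoS j : rho j.+1 = rho j / (2 * (1 + k (n j))) by [].
have rho0 j : 0 < rho j by elim: j => [|j IHj] //; rewrite rhoS divr_gt0// mulr_gt0.
have half j : 2 * rho j.+1 = rho j / (1 + k (n j)).
  by rewrite rhoS; field; rewrite gt_eqF.
have rho_half j : 2 * rho j.+1 <= rho j.
  by rewrite half ler_pdivrMr// ler_peMr ?lerDl// ltW.
have rho1 j : rho j <= 1.
  by elim: j => [|j IHj] //; have := rho_half j; have := rho0 j.+1; lra.
have zP j : rnorm (z j.+1 - z j) <= rho j /\ j.+1%:R <= rnorm (T (n j) (z j.+1)).
  exact: (gP (_, _, _) (rho0 j)).
have rho_cvg : 2 * rho j @[j --> \oo] --> 0.
  have h2 : `|2^-1 : R| < 1 by rewrite ger0_norm ?invr_ge0// invf_lt1// ltr1n.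
  apply: (@squeeze_cvgr _ _ _ _ (cst 0) (fun j => 2 * 2^-1 ^+ j)).
  - apply: nearW => j /=; rewrite mulr_ge0 ?(ltW (rho0 j))//= ler_wpM2l//.
    elim: j => [|j IHj]; first by rewrite expr0.
    by rewrite exprSr; have := rho_half j; lra.
  - exact: cvg_cst.
  - by rewrite -(mulr0 2); apply: cvgMr; exact: cvg_expr.
have dist i j : (i <= j)%N -> rnorm (z j - z i) <= 2 * rho i.
  move=> ij; suff : rnorm (z j - z i) <= 2 * rho i - 2 * rho j.
    by have := rho0 j; lra.
  elim: j ij => [|j IHj]; first by rewrite leqn0 => /eqP ->; rewrite !subrr rnorm0.
  rewrite leq_eqVlt => /predU1P[->|]; first by rewrite !subrr rnorm0.
  rewrite ltnS => /IHj h; apply: le_trans (rdist_triangle (z j) _ _) _.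
  by have := (zP j).1; have := rho_half j; lra.
have [l _ zl] := rcauchy_cvg rho_cvg dist.
have [C TC] := ptw l.
pose j := Num.trunc C.
have Cj : C < j.+1%:R by rewrite -truncn_le_nat.
have [_ Tz] := zP j.+1.
have := TC (n j.+1).
have := rnormB (T (n j.+1) l) (T (n j.+1) (l - z j.+2)).
rewrite -TB opprB addrC subrK.
have : rnorm (T (n j.+1) (l - z j.+2)) <= 1.
  apply: le_trans (Tk _ _) _.
  apply: le_trans (_ : k (n j.+1) * (2 * rho j.+2) <= _); first by rewrite ler_wpM2l.
  rewrite half mulrA ler_pdivrMr// mul1r.
  apply: (@le_trans _ _ (k (n j.+1))); first by rewrite ler_piMr.
  by rewrite lerDr.
move: Tz; rewrite -natr1; lra.
Qed.

End UniformBoundedness.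

(** * Operator norms *)

Section Operators.
Variables (R : realType) (H : completeNormedModType R[i]).
Implicit Types (f : {linear H -> H}) (x : H).

Lemma opnorm_has_sup f : bounded_near f (nbhs (0 : H)) ->
  has_sup [set rnorm (f x) | x in [set x : H | rnorm x <= 1]].
Proof.
move=> /linear_boundedP/pinfty_ex_gt0[K K0 fK]; split.
  by exists (rnorm (f 0)), 0 => //=; rewrite rnorm0.
exists (complex.Re K) => _ [x /= x1 <-].
have KE : K = ((complex.Re K)%:C)%C by rewrite RRe_real// gtr0_real.
have {}K0 : 0 <= complex.Re K by rewrite -lecR -KE ltW.
have := fK x; rewrite !rnormE KE -rmorphM /= lecR.
by move=> /le_trans; apply; rewrite ler_piMr.
Qed.

Lemma opnorm_ge0 f : bounded_near f (nbhs (0 : H)) -> 0 <= opnorm f.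
Proof.
move=> /opnorm_has_sup[_ ub]; apply: ub_le_sup => //.
by exists 0; rewrite /= ?rnorm0 ?linear0 ?rnorm0.
Qed.

Lemma opnorm_le f x : bounded_near f (nbhs (0 : H)) ->
  rnorm (f x) <= opnorm f * rnorm x.
Proof.
move=> bf; have [/rnorm_eq0 ->|x0] := eqVneq (rnorm x) 0.
  by rewrite linear0 rnorm0 mulr0.
have {}x0 : 0 < rnorm x by rewrite lt_neqAle eq_sym x0 rnorm_ge0.
have : rnorm (f ((rnorm x)^-1 *r x)) <= opnorm f.
  apply: ub_le_sup; first exact: (opnorm_has_sup bf).2.
  exists ((rnorm x)^-1 *r x) => //=.
  by rewrite rnormZ ger0_norm ?invr_ge0 ?(ltW x0)// mulVf ?gt_eqF.
by rewrite linearZ rnormZ ger0_norm ?invr_ge0 ?(ltW x0)// ler_pdivrMl// mulrC.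
Qed.

End Operators.

Section LocallyIntegrable.
Variable R : realType.
Local Notation mu := (@lebesgue_measure R).
Local Notation locint := (@locally_integrable R setT).

(** Local integrability on the whole line, for functions given on nonnegative
    times only, after extension by zero. *)
Lemma locint_restrict (g : R -> R) :
  (forall T, 0 <= T -> mu.-integrable `[0, T] (EFin \o g)) ->
  locint (g \_ `[0, +oo[).
Proof.
move=> ig; set h := _ \_ _.
have ih M : 0 < M -> mu.-integrable `[- M, M] (EFin \o h).
  move=> M0; rewrite -restrict_EFin; apply/integrable_restrict => //.
  rewrite (_ : _ `&` _ = `[0, M]%classic); first exact/ig/ltW.
  apply/seteqP; split => t /=; rewrite !in_itv /= ?andbT.
    by move=> [/andP[_ ->] ->].
  by move=> /andP[t0 tM]; rewrite t0 tM (le_trans _ t0)// oppr_le0 ltW.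
apply: locintP => //.
have -> : [set: R] = \bigcup_n `[- n.+1%:R, n.+1%:R]%classic.
  apply/seteqP; split => // t _; exists (Num.trunc `|t|) => //=.
  by rewrite in_itv /= -ler_norml ltW// -truncn_le_nat.
apply/measurable_fun_bigcup => // n.
by apply/measurable_EFinP; have /integrableP[] := ih n.+1%:R (ltr0Sn _ _).
Qed.

End LocallyIntegrable.

(** * Curves and strong continuity *)

Section Curves.
Variables (R : realType) (H : completeNormedModType R[i]).
Implicit Types (u v : R -> H).

Lemma within_nonneg_continuous u :
  {within `[0, +oo[, continuous u} -> nonneg_continuous u.
Proof.
move=> /subspace_continuousP cu t t0 e e0.
have /cu/rcvgP/(_ _ e0) : `[0, +oo[%classic t by rewrite /= in_itv /= t0.
rewrite near_withinE => /nbhs_ballP[d /= d0 hd]; exists d => // s s0 st.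
by apply: hd; rewrite /= ?in_itv /= ?s0// /ball /= distrC.
Qed.

Lemma straddle_derivativeB u v t x y :
  straddle_derivative u t x -> straddle_derivative v t y ->
  straddle_derivative (fun s => u s - v s) t (x - y).
Proof.
move=> du dv e e0.
have [d1 d10 h1] := du _ (divr_gt0 e0 (ltr0n R 2)).
have [d2 d20 h2] := dv _ (divr_gt0 e0 (ltr0n R 2)).
exists (Num.min d1 d2); first by rewrite lt_min d10.
move=> s s' s0 ds st ts' s'd.
have [m1 m2] : Num.min d1 d2 <= d1 /\ Num.min d1 d2 <= d2.
  by rewrite !ge_min !lexx orbT.
have {}h1 := h1 s s' s0 ltac:(lra) st ts' ltac:(lra).
have {}h2 := h2 s s' s0 ltac:(lra) st ts' ltac:(lra).
rewrite (_ : _ - _ = (u s' - u s - (s' - s) *r x) - (v s' - v s - (s' - s) *r y)).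
  by apply: le_trans (rnormB _ _) _; lra.
by rewrite scalerBr (subr_interchange (u s')) [LHS]subr_interchange.
Qed.

End Curves.

Section StrongContinuity.
Variables (R : realType) (H : completeNormedModType R[i]).

(** Joint continuity needs a bound on the operators near t; if there were none,
    a sequence of times converging to t would violate uniform boundedness, since
    strong continuity bounds each of its orbits. *)
Lemma nonneg_continuous_curve (M : R -> H -> H) (m : R -> R) (u : R -> H) :
  (forall t x y, 0 <= t -> M t (x + y) = M t x + M t y) ->
  (forall t (s : R) x, 0 <= t -> M t (s *r x) = s *r M t x) ->
  (forall t, 0 <= m t) ->
  (forall t x, 0 <= t -> rnorm (M t x) <= m t * rnorm x) ->
  (forall x, nonneg_continuous (fun t => M t x)) ->
  nonneg_continuous u -> nonneg_continuous (fun t => M t (u t)).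
Proof.
move=> MD MZ m0 Mm cM cu t t0.
have [K [d d0 KM]] : exists K, exists2 d : R, 0 < d &
    forall s x, 0 <= s -> `|s - t| < d -> rnorm (M s x) <= K * rnorm x.
  apply: contrapT => nK.
  have /choice[p pP] n : exists p : R * H, [/\ 0 <= p.1, `|p.1 - t| < n.+1%:R^-1 &
      n%:R * rnorm p.2 < rnorm (M p.1 p.2)].
    apply: contrapT => h; apply: nK; exists n%:R, n.+1%:R^-1; first by rewrite invr_gt0.
    move=> s x s0 st; rewrite leNgt; apply/negP => h'.
    by apply: h; exists (s, x).
  have [K KP] : exists K, forall n x, rnorm (M (p n).1 x) <= K * rnorm x.
    apply: (@uniform_boundedness _ _ (fun n => M (p n).1) (fun n => m (p n).1)) => //.
    - by move=> n x y; apply: MD; have [] := pP n.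
    - by move=> n s x; apply: MZ; have [] := pP n.
    - by move=> n x; apply: Mm; have [] := pP n.
    move=> x; have [e e0 he] := cM x t t0 1 ltr01.
    have [N _ hN] := @cvgr0_norm_lt _ _ _ _ _ _ (@cvg_harmonic R) _ e0.
    exists (1 + rnorm (M t x) + \sum_(i < N) rnorm (M (p i).1 x)) => n.
    have [nN|Nn] := ltnP n N.
      rewrite (bigD1 (Ordinal nN)) //= addrCA lerDl.
      by rewrite !addr_ge0 ?rnorm_ge0// sumr_ge0// => i _; rewrite rnorm_ge0.
    have [p0 pt _] := pP n.
    have := hN n Nn; rewrite /= ger0_norm ?invr_ge0// => ne.
    have := he _ p0 (lt_trans pt ne).
    have := rnormD (M (p n).1 x - M t x) (M t x); rewrite subrK.
    have : 0 <= \sum_(i < N) rnorm (M (p i).1 x).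
      by rewrite sumr_ge0// => i _; rewrite rnorm_ge0.
    lra.
  pose n := (Num.trunc K).+1.
  have Kn : K < n%:R by rewrite -truncn_le_nat.
  have [_ _] := pP n; rewrite ltNge => /negP; apply.
  by apply: le_trans (KP n _) _; rewrite ler_wpM2r ?rnorm_ge0// ltW.
move=> e e0.
have K0 : 0 < `|K| + 1 by rewrite ltr_pwDr.
have [d1 d10 h1] := cM (u t) t t0 _ (divr_gt0 e0 (ltr0n R 2)).
have [d2 d20 h2] := cu t t0 _ (divr_gt0 (divr_gt0 e0 (ltr0n R 2)) K0).
exists (Num.min d (Num.min d1 d2)); first by rewrite !lt_min d0 d10.
move=> s s0; rewrite !lt_min => /and3P[sd sd1 sd2].
apply: le_lt_trans (rdist_triangle (M s (u t)) _ _) _.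
have -> : M s (u s) - M s (u t) = M s (u s - u t).
  by rewrite MD// -[in RHS](rscale1 (u t)) -rscaleNl MZ// rscaleNl rscale1.
have {}h1 := h1 s s0 sd1; have {}h2 := h2 s s0 sd2.
rewrite [ltRHS]splitr ltrD//; apply: le_lt_trans (KM _ _ s0 sd) _.
apply: (@le_lt_trans _ _ ((`|K| + 1) * rnorm (u s - u t))).
  by rewrite ler_wpM2r ?rnorm_ge0// (le_trans (ler_norm _))// lerDl.
by rewrite mulrC -ltr_pdivlMr.
Qed.

End StrongContinuity.

(** * The evolution problem *)

Theorem proposition1 (R : realType) (H : completeNormedModType R[i])
    (ip : {dot H for Num.conj}) (hilbertH : is_hilbert ip)
    (A B : R -> {linear H -> H})
    (A_bounded : forall t : R, 0 <= t -> bounded_near (A t) (nbhs (0 : H)))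
    (B_bounded : forall t : R, 0 <= t -> bounded_near (B t) (nbhs (0 : H)))
    (A_meas : strongly_measurable_op A) (B_meas : strongly_measurable_op B)
    (A_locally_integrable : forall T : R, 0 <= T ->
       (@lebesgue_measure R).-integrable `[0, T]%classic
         (fun t => (opnorm (A t))%:E))
    (A_dissipative : forall (t : R) (x : H), 0 <= t ->
       complex.Re (ip (A t x) x) <= 0)
    (C : R)
    (normB_meas : measurable_fun (`[0, +oo[%classic : set (measurableTypeR R))
       (fun t => opnorm (B t)))
    (C_def : (\int[@lebesgue_measure R]_(t in `[0%R, +oo[%classic)
         (opnorm (B t))%:E)%E
       = C%:E)
    (u0 : H) :
  exists u : R -> H,
    [/\ is_solution A B u0 u,
        forall v, is_solution A B u0 v -> forall t : R, 0 <= t -> v t = u t,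
        (ereal_sup [set (rnorm (u t))%:E | t in `[0%R, +oo[%classic]
           <= (expR C * rnorm u0)%:E)%E
      & strongly_continuous_op A -> strongly_continuous_op B ->
        forall t : R, 0 <= t -> has_derivative u t (A t (u t) + B t (u t))].
Proof.
pose mu := @lebesgue_measure R.
(* extended by 0 to negative times, both norms are locally integrable on R *)
pose a := (fun t => opnorm (A t)) \_ `[0, +oo[.
pose b := (fun t => opnorm (B t)) \_ `[0, +oo[.
have mem0 (t : R) : 0 <= t -> t \in `[0, +oo[%classic.
  by move=> t0; rewrite mem_set//= in_itv /= t0.
have aE t : 0 <= t -> a t = opnorm (A t) by move=> t0; rewrite /a patchE mem0.
have bE t : 0 <= t -> b t = opnorm (B t) by move=> t0; rewrite /b patchE mem0.
have a0 t : 0 <= a t.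
  rewrite /a patchE; case: ifPn => // /set_mem /=; rewrite in_itv /= andbT => t0.
  exact/opnorm_ge0/A_bounded.
have b0 t : 0 <= b t.
  rewrite /b patchE; case: ifPn => // /set_mem /=; rewrite in_itv /= andbT => t0.
  exact/opnorm_ge0/B_bounded.
have la : locally_integrable setT a by exact: locint_restrict.
have ib : mu.-integrable `[0, +oo[ (EFin \o (fun t => opnorm (B t))).
  apply/integrableP; split; first exact/measurable_EFinP.
  rewrite (_ : (\int[mu]_(t in _) _)%E = C%:E) ?ltry//.
  rewrite -C_def; apply: eq_integral => t /set_mem /=; rewrite in_itv /= andbT => t0.
  by rewrite ger0_norm// -bE.
have lb : locally_integrable setT b.
  apply: locint_restrict => T T0; apply: integrableS ib => //.
  by apply: subset_itvl; rewrite bnd_simp.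
have bC t : 0 <= t -> primitive b t <= C.
  move=> t0; rewrite -[leRHS]/(fine C%:E) -C_def /primitive /Rintegral fine_le//.
  - by apply: integrable_fin_num => //; exact: locint_itvoc.
  - by rewrite C_def.
  - apply: le_trans (_ : (\int[mu]_(s in `]0%R, t]) (opnorm (B s))%:E <= _)%E).
      rewrite le_eqVlt; apply/orP; left; apply/eqP; apply: eq_integral.
      move=> s /set_mem /=; rewrite in_itv /= => /andP[s0 _].
      by rewrite bE// ltW.
    apply: ge0_subset_integral => //.
    + exact/measurable_EFinP.
    + move=> s /=; rewrite in_itv /= andbT => s0.
      by rewrite lee_fin -bE.
    + by apply: subset_itv; rewrite bnd_simp.
pose M t x := A t x + B t x.
pose m t := a t + b t.
have m0 t : 0 <= m t by rewrite addr_ge0.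
have lm : locally_integrable setT m by exact: locally_integrableD.
have MD t x y : M t (x + y) = M t x + M t y.
  by rewrite /M !linearD addrACA.
have MZ t (s : R) x : M t (s *r x) = s *r M t x by rewrite /M !linearZ scalerDr.
have MB t x y : M t (x - y) = M t x - M t y.
  by rewrite /M !linearB opprD addrACA.
have Mm t x : 0 <= t -> rnorm (M t x) <= m t * rnorm x.
  move=> t0; rewrite /M /m mulrDl aE// bE// (le_trans (rnormD _ _))// lerD//.
    exact/opnorm_le/A_bounded.
  exact/opnorm_le/B_bounded.
have M_pettis x : ae_pettis_measurable (fun t => M t x).
  exact: ae_pettis_stronglyD (A_meas x) (B_meas x).
have M_lip t x y : 0 <= t -> rnorm (M t x - M t y) <= m t * rnorm (x - y).
  by move=> t0; rewrite -MB Mm.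
have M_0 t : 0 <= t -> M t 0 = 0 by rewrite /M !linear0 addr0.
have M_diss t x : 0 <= t -> rip ip (M t x) x <= b t * rnorm x ^+ 2.
  move=> t0; rewrite /M ripDl bE//.
  have := A_dissipative t x t0; rewrite -/(rip ip (A t x) x).
  have := rip_le hilbertH (B t x) x.
  have := ler_wpM2r (rnorm_ge0 x) (opnorm_le x (B_bounded t t0)).
  by rewrite expr2 mulrA; lra.
have [u cu [f [bf fK aef fu u_0]]] :=
  solution_exists hilbertH lm m0 M_pettis M_lip M_0 u0.
have lh : locally_integrable setT (fun t => 2 * rnorm u0 * (m t * weight m t)).
  apply: locintZl; [exact: locint_mweight|exact: mweight_ge0|].
  by rewrite mulr_ge0// rnorm_ge0.
(* the increments of u are dominated by those of a primitive *)
have acu T : 0 <= T -> curve_ac T u.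
  move=> T0.
  have ach : small_increments T (fun s t =>
      primitive (fun t => 2 * rnorm u0 * (m t * weight m t)) t -
      primitive (fun t => 2 * rnorm u0 * (m t * weight m t)) s).
    apply: small_increments_primitive => // t.
    exact: le_trans (rnorm_ge0 _) (fK t).
  apply: (small_increments_dom ler01 ach ach) => s t s0 st tT.
  have := weak_primitive_bound hilbertH bf fu lh fK s0 st.
  have := rnorm_ge0 (u t - u s); lra.
have du : {ae mu, forall t, 0 <= t -> straddle_derivative u t (M t (u t))}.
  apply: aeS2 (ae_straddle_derivative hilbertH bf fu) aef => t ut ft t0.
  by rewrite -ft//; exact: ut.
exists u; split.
- split => //; first by move=> T T0; apply/curve_acP; exact: acu.
  by apply: aeS du => t ut t0; apply/has_derivativeP => //; exact: ut.
- move=> v [acv dv v_0] t t0.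
  apply/eqP; rewrite -subr_eq0; apply/eqP/(@rnorm_eq0 R H)/eqP.
  rewrite eq_le rnorm_ge0 andbT.
  have := energy_bound hilbertH lb b0
    (v := fun t => v t - u t) (l := fun t => M t (v t) - M t (u t)) _ _ t0.
  rewrite v_0 u_0 subrr rnorm0 mulr0; apply.
    by move=> T T0; apply: curve_acB; [apply/curve_acP; exact: acv|exact: acu].
  apply: aeS2 dv du => s vs us s0; split.
    apply: straddle_derivativeB; last exact: us.
    by apply/has_derivativeP => //; exact: vs.
  by rewrite -MB; exact: M_diss.
- apply: ge_ereal_sup => x [t /=]; rewrite in_itv /= andbT => t0 <-.
  rewrite lee_fin -u_0.
  apply: le_trans (energy_bound hilbertH lb b0 acu (l := fun t => M t (u t)) _ t0) _.
    by apply: aeS du => s us s0; split; [exact: us|exact: M_diss].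
  by rewrite ler_wpM2r ?rnorm_ge0// ler_expR bC.
- move=> cA cB t t0; apply/has_derivativeP => //.
  have cM x : nonneg_continuous (fun t => M t x).
    apply: within_nonneg_continuous => s; apply: cvgD; [exact: cA|exact: cB].
  have cMu := nonneg_continuous_curve (fun t x y _ => MD t x y)
    (fun t s x _ => MZ t s x) m0 Mm cM cu.
  apply: (straddle_derivative_near hilbertH bf fu) => e e0.
  have [d d0 hd] := cMu t t0 e e0; exists d => //.
  by apply: aeS aef => r fr r0 rd; rewrite fr// ltW// hd.
Qed.
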